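(* Let $k=k(n)$ be a sequence of integers with $1\le k\le n$, and let $t'$ be a fixed real number. (i) If $t'<-\tfrac12$ and $k \leq \log (n) + t'\log \log (n)\sqrt{\log (n)}$, then the random graph $\mathit{LK}(n,k)$ is not connected with high probability. (ii) If $t'>\tfrac12$ and $k \geq \log (n) + t'\log \log (n)\sqrt{\log (n)}$, then $\mathit{LK}(n,k)$ is connected with high probability.
   Context: The bilateral preference random graph $\mathit{LK}(n,k)$ has vertex set $[n]=\{1,\dots,n\}$ and is built as follows. Assign i.i.d. uniform $[0,1]$ weights to the $\binom n2$ edges of the complete graph on $[n]$ (almost surely distinct). The edge $(i,j)$ is present in $\mathit{LK}(n,k)$ if and only if it is among the $k$ edges of lowest weight incident to vertex $i$ and also among the $k$ edges of lowest weight incident to vertex $j$. ''With high probability'' means with probability tending to $1$ as $n\to\infty$. $\log$ is the natural logarithm. *)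

(* Defs.v *)
From mathcomp Require Import all_boot all_order all_algebra.
From mathcomp Require Import all_classical all_reals all_analysis.
Import Order.TTheory GRing.Theory Num.Theory.

Set Implicit Arguments.
Unset Strict Implicit.
Unset Printing Implicit Defensive.

Local Open Scope ring_scope.

Definition edge (n : nat) := {e : {set 'I_n} | #|e| == 2%N}.

Section LK.
Context {R : realType} {n : nat}.
Implicit Types (x : edge n -> R) (k : nat) (e : edge n) (v : 'I_n).

(* Fewer than k edges at v are strictly lighter than e.  For pairwise distinct
   weights, the edges satisfying this are exactly the k lightest ones at v
   (all edges at v when k >= n.-1). *)
Definition among_lowest x k v e : bool :=
  (v \in val e) && (#|[pred f : edge n | (v \in val f) && (x f < x e)%R]| < k)%N.

Definition LK x k : rel 'I_n := fun i j =>
  [exists e : edge n,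
    [&& val e == [set i; j]%SET, among_lowest x k i e & among_lowest x k j e]].

Definition graph_connected (g : rel 'I_n) : Prop :=
  forall i j : 'I_n, connect g i j.

End LK.

Local Open Scope classical_set_scope.

Section probability.
Context {R : realType} {d : measure_display} {T : measurableType d}.
Variable P : probability T R.

Definition mutually_independent (I : finType) (X : I -> {RV P >-> R}) : Prop :=
  forall (J : {set I}) (B : I -> set R),
    (forall i, i \in J -> measurable (B i)) ->
    P [set w | forall i, i \in J -> B i (X i w)] =
      (\prod_(i in J) P (X i @^-1` B i))%E.

Definition iid_uniform01 (I : finType) (X : I -> {RV P >-> R}) : Prop :=
  mutually_independent X /\
  forall (i : I) (A : set R), measurable A ->
    distribution P (X i) A = uniform_prob (@ltr01 R) A.

End probability.

Definition whp {R : realType} {d : nat -> measure_display}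
    {T : forall n, measurableType (d n)} (P : forall n, probability (T n) R)
    (E : forall n, set (T n)) : Prop :=
  P n (E n) @[n --> \oo] --> 1%:E.

(* Main.v *)
Require Import Defs.
From mathcomp Require Import all_boot all_order all_algebra.
From mathcomp Require Import all_classical all_reals all_analysis.
From mathcomp Require Import zify ring lra.
Import Order.TTheory GRing.Theory Num.Theory.

Set Implicit Arguments.
Unset Strict Implicit.
Unset Printing Implicit Defensive.

Local Open Scope ring_scope.

(** Write L = ln n, and let G_t be the graph formed by the edges of weight
    less than t.  Both halves compare LK(n,k) with such graphs, at a level
    p = s/n with s halfway between L and the bound on k, so that the distances
    from s to L and to k are both at least (1/4) ln L sqrt L.  The degrees in
    G_p fluctuate by sqrt L, so the second distance makes the probability that
    the degree of a vertex lies on the wrong side of k smaller than every power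
    of L (an exponential Markov bound); the first distance absorbs all error
    terms of order sqrt L in the exponent.

    In the first half s < L, and G_p has isolated vertices: their number has
    a large mean and is concentrated (second moment).  Let v be one of them.
    With few exceptions, controlled by a first moment, the k lightest edges at
    v have weight less than q = 16 L/n, and each neighbour j of v along an edge
    lighter than q has at least k edges of weight less than p.  The edge from
    v to j has weight at least p, so it is not among the k lightest ones at j,
    and v is isolated in LK (isolated_LK, no_doomed_bound).

    In the second half s > L, and k may be lowered to an integer K close to its
    bound, since LK grows with k.  For p0 = L/(e^3 n), which is so small that
    all degrees of G_p0 are at most K, and q = 16 L/n, which is so large that
    they are at least K in G_q, LK lies between G_p0 and G_q.  All LK degrees
    are at least 2: let B_v be the set of the edges from v to vertices that
    have K edges of weight less than p without counting the edge to v.  It is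
    independent of the weights at v and, with high probability for all v at
    once, contains at most n/sqrt L edges; thus v has many edges in G_p that
    avoid B_v, and they are present at their other ends.  The two lightest of
    them are also present at v, unless almost K edges of G_p at v belong to B_v
    (LKdegree_ge2).  Now a component S of LK with r <= n/2 vertices has no
    G_p0 edge to its complement and contains at least r edges of G_q.  The
    expected number of such sets is at most (C L n^-c)^r for some constants C
    and c > 0, because of the factor n^-(cr) from the absent G_p0 edges
    (disconnected_sparse_cut, sparse_cut_term), and the sum over r is small.

    All these events only involve, for each edge, the position of its weight
    with respect to three thresholds.  So all probabilities are finite sums
    for a product law on functions from edges to four classes
    (prob_wclasses). *)

(** * Finite product laws *)

Section FiniteProduct.
Import fintype boot.finset.
Variables (R : realFieldType) (I K : finType) (m : K -> R).
Hypothesis m_ge0 : forall c, 0 <= m c.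
Hypothesis m_sum1 : \sum_c m c = 1.
Implicit Types (x y : {ffun I -> K}) (A B C : {set I}) (F G : {ffun I -> K} -> R).
Implicit Types (Q : pred {ffun I -> K}).

Definition pmf x : R := \prod_i m (x i).
Definition Ex F : R := \sum_x pmf x * F x.
Definition Pr Q : R := Ex (fun x => (Q x)%:R).
Definition occ A (c : pred K) x : nat := #|[set i in A | c (x i)]|.
Definition mass (c : pred K) : R := \sum_(a | c a) m a.

Lemma pmf_ge0 x : 0 <= pmf x.
Proof. exact: prodr_ge0. Qed.

Lemma Ex_prod (f : I -> K -> R) :
  Ex (fun x => \prod_i f i (x i)) = \prod_i \sum_c m c * f i c.
Proof.
by rewrite bigA_distr_bigA; apply: eq_bigr => x _; rewrite -big_split.
Qed.

(** Independence of the coordinates, in a form where an event can be replaced by an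
    exponential bound for its indicator.  Three blocks occur when the edges at a
    vertex, one of them and the edges at its other end are considered jointly. *)
Lemma Ex_prod3 A B C (f g h : K -> R) :
  [disjoint A & B] -> [disjoint A & C] -> [disjoint B & C] ->
  Ex (fun x => (\prod_(i in A) f (x i)) * (\prod_(i in B) g (x i)) *
               \prod_(i in C) h (x i)) =
  (\sum_c m c * f c) ^+ #|A| * (\sum_c m c * g c) ^+ #|B| *
  (\sum_c m c * h c) ^+ #|C|.
Proof.
move=> dAB dAC dBC.
pose k i c := (if i \in A then f c else 1) * (if i \in B then g c else 1) *
              (if i \in C then h c else 1).
transitivity (Ex (fun x => \prod_i k i (x i))).
  apply: eq_bigr => x _; congr (_ * _).
  by rewrite !big_split /= -!big_mkcond.
rewrite Ex_prod -!prodr_const [X in X * _ * _]big_mkcond.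
rewrite [X in _ * X * _]big_mkcond [X in _ * _ * X]big_mkcond -!big_split /=.
apply: eq_bigr => i _; rewrite /k.
case: (boolP (i \in A)) => iA.
  rewrite (disjointFr dAB iA) (disjointFr dAC iA) !mulr1.
  by apply: eq_bigr => c _; rewrite !mulr1.
case: (boolP (i \in B)) => iB.
  rewrite (disjointFr dBC iB) mulr1 mul1r.
  by apply: eq_bigr => c _; rewrite mulr1 mul1r.
case: (boolP (i \in C)) => iC; rewrite ?mul1r ?mulr1.
  by apply: eq_bigr => c _; rewrite !mul1r.
by rewrite -[RHS]m_sum1; apply: eq_bigr => c _; rewrite !mulr1.
Qed.

Lemma Ex_prod2 A B (f g : K -> R) : [disjoint A & B] ->
  Ex (fun x => (\prod_(i in A) f (x i)) * \prod_(i in B) g (x i)) =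
  (\sum_c m c * f c) ^+ #|A| * (\sum_c m c * g c) ^+ #|B|.
Proof.
have d0 (D : {set I}) : [disjoint D & finset.set0].
  by rewrite disjoint_sym disjoint_subset; apply/subsetP => i; rewrite inE.
move=> dAB; have := Ex_prod3 f g (fun=> 1) dAB (d0 A) (d0 B).
rewrite cards0 expr0 mulr1 => <-.
by apply: eq_bigr => x _; rewrite big_set0 mulr1.
Qed.

Lemma Ex_prod1 A (f : K -> R) :
  Ex (fun x => \prod_(i in A) f (x i)) = (\sum_c m c * f c) ^+ #|A|.
Proof.
have dA0 : [disjoint A & finset.set0].
  by rewrite disjoint_sym disjoint_subset; apply/subsetP => i; rewrite inE.
have := Ex_prod2 f (fun=> 1) dA0; rewrite cards0 expr0 mulr1 => <-.
by apply: eq_bigr => x _; rewrite big_set0 mulr1.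
Qed.

Lemma Ex1 : Ex (fun=> 1) = 1.
Proof.
transitivity (Ex (fun x => \prod_(i in finset.set0) (fun=> 1) (x i))).
  by apply: eq_bigr => x _; rewrite big_set0.
have -> := Ex_prod1 finset.set0 (fun=> 1); by rewrite cards0 expr0.
Qed.

Lemma Ex_sum (J : finType) (P : pred J) (F : J -> {ffun I -> K} -> R) :
  Ex (fun x => \sum_(j | P j) F j x) = \sum_(j | P j) Ex (F j).
Proof.
rewrite exchange_big /=; apply: eq_bigr => x _; exact: mulr_sumr.
Qed.

Lemma Ex_scale a F : Ex (fun x => a * F x) = a * Ex F.
Proof. by rewrite mulr_sumr; apply: eq_bigr => x _; rewrite mulrCA. Qed.

Lemma ExD F G : Ex (fun x => F x + G x) = Ex F + Ex G.
Proof. by rewrite -big_split; apply: eq_bigr => x _; rewrite mulrDr. Qed.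

Lemma le_Ex F G : (forall x, F x <= G x) -> Ex F <= Ex G.
Proof.
by move=> FG; apply: ler_sum => x _; apply: ler_wpM2l; rewrite ?pmf_ge0.
Qed.

Lemma Pr_le_Ex Q F : (forall x, 0 <= F x) -> (forall x, Q x -> 1 <= F x) ->
  Pr Q <= Ex F.
Proof.
by move=> F0 F1; apply: le_Ex => x; case: (boolP (Q x)) => [/F1|].
Qed.

Lemma Pr_sub Q Q' : (forall x, Q x -> Q' x) -> Pr Q <= Pr Q'.
Proof. by move=> QQ; apply: Pr_le_Ex => // x /QQ ->. Qed.

Lemma Pr_or Q Q' : Pr (predU Q Q') <= Pr Q + Pr Q'.
Proof.
by rewrite -ExD; apply: le_Ex => x /=; case: (Q x); case: (Q' x);
  rewrite ?addr0 ?add0r // lerDl.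
Qed.

Lemma Pr_exists (J : finType) (P : pred J) (Q : J -> pred {ffun I -> K}) :
  Pr (fun x => [exists j, P j && Q j x]) <= \sum_(j | P j) Pr (Q j).
Proof.
rewrite -Ex_sum; apply: Pr_le_Ex => [x|x /existsP[j /andP[Pj Qj]]].
  exact: sumr_ge0.
by rewrite (bigD1 j) //= Qj lerDl sumr_ge0.
Qed.

Lemma Pr_exists_le (J : finType) (Q : J -> pred {ffun I -> K}) a :
  (forall j, Pr (Q j) <= a) -> Pr (fun x => [exists j, Q j x]) <= #|J|%:R * a.
Proof.
move=> Qa; apply: le_trans (_ : \sum_j Pr (Q j) <= _).
  by apply: le_trans (Pr_exists xpredT Q); apply: Pr_sub.
by rewrite mulr_natl -sumr_const; apply: ler_sum.
Qed.

Lemma Pr_predC Q : Pr (predC Q) = 1 - Pr Q.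
Proof.
apply/eqP; rewrite eq_sym subr_eq -ExD -{1}Ex1; apply/eqP/eq_bigr => x _.
by rewrite /=; case: (Q x); rewrite ?add0r ?addr0.
Qed.

Lemma prod_indic A (c : pred K) x :
  \prod_(i in A) (c (x i))%:R = [forall i in A, c (x i)]%:R :> R.
Proof.
case: (boolP [forall i in A, c (x i)]) => [/forall_inP cA|].
  by rewrite big1 // => i /cA ->.
rewrite negb_forall => /existsP[i]; rewrite negb_imply => /andP[iA /negPf ci].
by rewrite (bigD1 i) //= ci mul0r.
Qed.

Lemma prod_occ A (c : pred K) z x :
  \prod_(i in A) (if c (x i) then z else 1) = z ^+ occ A c x :> R.
Proof.
rewrite -big_mkcondr /= -prodr_const; apply: eq_bigl => i.
by rewrite inE.
Qed.

Lemma mass_indic (c : pred K) : \sum_a m a * (c a)%:R = mass c.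
Proof.
rewrite [RHS]big_mkcond; apply: eq_bigr => a _.
by case: (c a); rewrite ?mulr1 ?mulr0.
Qed.

Lemma mass_pgf (c : pred K) z :
  \sum_a m a * (if c a then z else 1) = 1 - mass c * (1 - z).
Proof.
rewrite -[X in X - _]m_sum1 -mass_indic mulr_suml -sumrB; apply: eq_bigr => a _.
by case: (c a); rewrite ?mulr1 ?mulr0 ?mul0r ?subr0 // mulrBr mulr1 opprB addrC subrK.
Qed.

(** Markov's inequality for z ^+ occ A c x, whose expectation is a product. *)
Lemma occ_ge_tail A (c : pred K) (z : R) k : 1 <= z ->
  Pr (fun x => (k <= occ A c x)%N) <=
  z ^- k * (1 - mass c * (1 - z)) ^+ #|A|.
Proof.
move=> z1; have z0 : 0 < z by apply: lt_le_trans z1.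
rewrite -mass_pgf -Ex_prod1 -Ex_scale; apply: Pr_le_Ex => x.
  by rewrite prod_occ mulr_ge0 ?invr_ge0 ?exprn_ge0 ?ltW.
move=> kx; rewrite prod_occ ler_pdivlMl ?exprn_gt0 // mulr1.
exact: ler_weXn2l.
Qed.

Lemma occ_le_tail A (c : pred K) (z : R) k : 0 < z <= 1 ->
  Pr (fun x => (occ A c x <= k)%N) <=
  z ^- k * (1 - mass c * (1 - z)) ^+ #|A|.
Proof.
move=> /andP[z0 z1].
rewrite -mass_pgf -Ex_prod1 -Ex_scale; apply: Pr_le_Ex => x.
  by rewrite prod_occ mulr_ge0 ?invr_ge0 ?exprn_ge0 ?ltW.
move=> kx; rewrite prod_occ ler_pdivlMl ?exprn_gt0 // mulr1.
by apply: ler_wiXn2l; rewrite // ltW.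
Qed.

Definition mix A x y : {ffun I -> K} :=
  [ffun i => if i \in A then x i else y i].

(** Conditioning on what happens off A.  Exchanging the coordinates in A of two
    independent copies preserves their joint law, so Y may be evaluated at one
    copy and Q at the other; the bound then holds for each value of Y. *)
Lemma Pr_decouple (T : eqType) A (Y : {ffun I -> K} -> T)
    (Q : T -> pred {ffun I -> K}) a :
  (forall x y, {in ~: A, x =1 y} -> Y x = Y y) ->
  (forall t x y, {in A, x =1 y} -> Q t x = Q t y) ->
  (forall y, Pr (Q (Y y)) <= a) ->
  Pr (fun x => Q (Y x) x) <= a.
Proof.
move=> YA QA Pa.
have -> : Pr (fun x => Q (Y x) x) =
    \sum_p pmf p.1 * pmf p.2 * (Q (Y p.1) p.1)%:R.
  rewrite -(pair_bigA _ (fun x y => pmf x * pmf y * (Q (Y x) x)%:R)) /=.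
  apply: eq_bigr => x _; rewrite -big_distrl -big_distrr /=; congr (_ * _).
  have := Ex1; rewrite /Ex => h.
  by rewrite -[LHS]mulr1; congr (_ * _); rewrite -h; apply: eq_bigr => y _; rewrite mulr1.
(* s exchanges the coordinates in A of the two copies. *)
pose s (p : {ffun I -> K} * {ffun I -> K}) := (mix A p.1 p.2, mix A p.2 p.1).
have sK : involutive s.
  move=> [x y]; congr (_, _); apply/ffunP => i; rewrite !ffunE /=;
  by case: (i \in A).
rewrite (reindex_inj (inv_inj sK)) /=.
have -> : \sum_p pmf (mix A p.1 p.2) * pmf (mix A p.2 p.1) *
      (Q (Y (mix A p.1 p.2)) (mix A p.1 p.2))%:R =
    \sum_p pmf p.1 * pmf p.2 * (Q (Y p.2) p.1)%:R.
  apply: eq_bigr => -[x y] _ /=; congr (_ * _%:R).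
    rewrite -!big_split; apply: eq_bigr => i _ /=; rewrite !ffunE.
    by case: ifP => // _; rewrite mulrC.
  rewrite (YA (mix A x y) y); last first.
    by move=> i; rewrite inE ffunE => /negPf->.
  by congr (_ : bool); apply: QA => i iA; rewrite ffunE iA.
rewrite -(pair_bigA _ (fun x y => pmf x * pmf y * (Q (Y y) x)%:R)) exchange_big /=.
have -> : a = Ex (fun=> a).
  by rewrite -[LHS]mulr1 -Ex1 -Ex_scale; apply: eq_bigr => x _; rewrite mulr1.
apply: ler_sum => y _.
have -> : \sum_x pmf x * pmf y * (Q (Y y) x)%:R = pmf y * Pr (Q (Y y)).
  by rewrite mulr_sumr; apply: eq_bigr => x _; rewrite mulrCA mulrA.
by rewrite ler_wpM2l ?pmf_ge0.
Qed.

End FiniteProduct.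

(** * Edge sets of the complete graph, and what LK depends on *)

Section Edges.
Import fintype boot.finset.
Variable n : nat.
Implicit Types (e f : edge n) (v i j : 'I_n) (S : {set 'I_n}) (A G : {set edge n}).

Definition star v : {set edge n} := [set e : edge n | v \in val e].
Definition inside S : {set edge n} := [set e : edge n | val e \subset S].
Definition crossing S : {set edge n} :=
  [set e : edge n | ~~ [disjoint val e & S] && ~~ (val e \subset S)].

Lemma in_star v e : (e \in star v) = (v \in val e).
Proof. by rewrite inE. Qed.

Lemma edge_set2 i j : i != j -> {e : edge n | val e = [set i; j]%SET}.
Proof.
move=> ij; have c2 : #|[set i; j]%SET| == 2%N by rewrite cards2 ij.
by exists (Sub [set i; j]%SET c2); rewrite SubK.
Qed.

Lemma edge_ends e i j : i != j -> i \in val e -> j \in val e ->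
  val e = [set i; j]%SET.
Proof.
move=> ij ie je; apply/esym/eqP; rewrite eqEcard (eqP (valP e)) cards2 ij.
by rewrite andbT; apply/subsetP => u; rewrite !inE => /orP[] /eqP->.
Qed.

Lemma edge_other e i : i \in val e -> exists2 j, j != i & val e = [set i; j]%SET.
Proof.
move=> ie; have : #|val e :\ i| = 1%N.
  by have := cardsD1 i (val e); rewrite (eqP (valP e)) ie => -[].
move/eqP/cards1P => [j Ej]; have : j \in val e :\ i by rewrite Ej set11.
rewrite !inE => /andP[ji je]; exists j => //.
by apply: edge_ends; rewrite // eq_sym.
Qed.

Lemma card_star v : #|star v| = n.-1.
Proof.
rewrite -(card_imset (mem (star v)) val_inj).
have -> : [set val e | e in star v] = [set [set v; j]%SET | j in ~: [set v]].
  apply/setP => D; apply/imsetP/imsetP => [[e]|[j]].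
    rewrite in_star => /edge_other[j jv ee] ->.
    by exists j; rewrite // !inE.
  rewrite !inE eq_sym => vj ->; have [e ee] := edge_set2 vj.
  by exists e; rewrite // in_star ee !inE eqxx.
rewrite card_in_imset ?cardsC1 ?card_ord // => i j; rewrite !inE => iv jv /setP/(_ i).
by rewrite !inE eqxx orbT (negPf iv) => /esym/eqP.
Qed.

Lemma card_starI i j : i != j -> (#|star i :&: star j| <= 1)%N.
Proof.
move=> ij; apply/card_le1_eqP => e f; rewrite !inE => /andP[ie je] /andP[jf ff].
by apply: val_inj; rewrite (edge_ends ij ie je) (edge_ends ij jf ff).
Qed.

Lemma card_inside S : (#|inside S| <= #|S| * #|S|)%N.
Proof.
rewrite -cardsX -(card_imset (mem (inside S)) val_inj).
apply: leq_trans (leq_imset_card (fun p : 'I_n * 'I_n => [set p.1; p.2]%SET) _).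
apply/subset_leq_card/subsetP => _ /imsetP[e + ->]; rewrite inE => /subsetP eS.
have /set0Pn[i ie] : val e != finset.set0 by rewrite -card_gt0 (eqP (valP e)).
have [j ji ee] := edge_other ie; apply/imsetP; exists (i, j); last exact: ee.
by rewrite !inE /= !eS // ee !inE eqxx ?orbT.
Qed.

Lemma card_crossing S : (#|S| * (n - #|S|) <= #|crossing S|)%N.
Proof.
have -> : (n - #|S| = #|~: S|)%N by rewrite (cardsCs (~: S)) setCK card_ord.
rewrite -cardsX -(card_imset (mem (crossing S)) val_inj).
have /card_in_imset <- : {in setX S (~: S) &,
    injective (fun p : 'I_n * 'I_n => [set p.1; p.2]%SET)}.
  move=> [i j] [i' j'] /setXP[/= iS jS] /setXP[/= iS' jS'] /setP E.
  move: jS jS'; rewrite !inE => jS jS'.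
  have := E i; rewrite !inE eqxx /= => /esym/orP[/eqP->|/eqP ij'].
    2: by rewrite -ij' iS in jS'.
  have := E j; rewrite !inE eqxx orbT /= => /esym/orP[/eqP ji|/eqP->//].
  by rewrite ji iS' in jS.
apply/subset_leq_card/subsetP => _ /imsetP[[i j] /setXP[/= iS]] + ->.
rewrite inE => jS.
have ij : i != j by apply: contraNneq jS => <-.
have [e ee] := edge_set2 ij; apply/imsetP; exists e => //.
rewrite !inE ee; apply/andP; split.
  by apply/pred0Pn; exists i; rewrite /= !inE eqxx.
by apply/subsetPn; exists j; rewrite // !inE eqxx orbT.
Qed.

Lemma handshake A : (\sum_v #|A :&: star v| = #|A|.*2)%N.
Proof.
transitivity (\sum_v \sum_(e in A) (v \in val e))%N.
  apply: eq_bigr => v _; rewrite -sum1_card big_mkcond [RHS]big_mkcond /=.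
  by apply: eq_bigr => e _; rewrite !inE; case: (e \in A); case: (v \in val e).
rewrite exchange_big /= -muln2 -sum_nat_const; apply: eq_bigr => e _.
by rewrite -big_mkcond sum1_card (eqP (valP e)).
Qed.

End Edges.

Section Deterministic.
Import fintype boot.finset.
Context {R : realType} {n : nat}.
Implicit Types (x : edge n -> R) (k : nat) (e f : edge n) (v i j : 'I_n).
Implicit Types (S : {set 'I_n}) (G : {set edge n}) (t : R).

Definition light x t : {set edge n} := [set e : edge n | (x e < t)%R].
Definition LKedges x k : {set edge n} :=
  [set e : edge n | [forall v in val e, among_lowest x k v e]].

(** An edge at v in this set may be excluded from LK by its other end.  The
    edges at v are discounted so that the set does not depend on them. *)
Definition saturated G k v : {set edge n} :=
  [set e in star v | [exists j in val e,
     (j != v) && (k <= #|G :&: star j :\: star v|)%N]].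

Lemma among_lowestE x k v e :
  among_lowest x k v e = (e \in star v) && (#|light x (x e) :&: star v| < k)%N.
Proof.
rewrite /among_lowest in_star; congr (_ && (_ < _)%N).
by apply: eq_card => f; rewrite !inE andbC.
Qed.

Lemma LKedgesP x k e :
  reflect (forall v, v \in val e -> #|light x (x e) :&: star v| < k)%N
    (e \in LKedges x k).
Proof.
rewrite inE; apply: (iffP forall_inP) => h v ve; have := h v ve;
  by rewrite among_lowestE in_star ve.
Qed.

Lemma LK_edge x k i j :
  reflect (exists2 e, val e = [set i; j]%SET & e \in LKedges x k) (LK x k i j).
Proof.
apply: (iffP existsP) => [[e /and3P[/eqP ee ei ej]]|[e ee /LKedgesP h]]; exists e.
- by [].
- by rewrite inE ee; apply/forall_inP => v; rewrite !inE => /orP[] /eqP->.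
- by rewrite ee eqxx !among_lowestE !in_star ee !inE !eqxx orbT /= !h // ee !inE eqxx ?orbT.
Qed.

Lemma LK_sym x k : symmetric (LK x k).
Proof. by move=> i j; apply/LK_edge/LK_edge => -[e]; rewrite setUC; exists e. Qed.

(** An edge e of weight less than t does not count among the at most k lighter
    ones at each end, which leaves fewer than k strictly lighter edges. *)
Lemma light_sub_LKedges x t k :
  (forall v, #|light x t :&: star v| <= k)%N -> light x t \subset LKedges x k.
Proof.
move=> h; apply/subsetP => e; rewrite inE => et; apply/LKedgesP => v ve.
apply: leq_trans (h v); apply: proper_card; apply/properP; split.
  by apply/subsetP => f; rewrite !inE => /andP[fe ->]; rewrite (lt_trans fe et).
by exists e; rewrite !inE ?ltxx // ve et.
Qed.

Lemma LKedges_light x t k v e : (k <= #|light x t :&: star v|)%N ->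
  v \in val e -> e \in LKedges x k -> e \in light x t.
Proof.
move=> kt ve /LKedgesP/(_ v ve) ek; rewrite inE ltNge; apply: contraL ek => te.
rewrite -leqNgt; apply: leq_trans kt _; apply/subset_leq_card/subsetP => f.
by rewrite !inE => /andP[ft ->]; rewrite (lt_le_trans ft te).
Qed.

(** Take the lightest edge e1 and the second lightest one e2 in A :\: B.  Except for
    e1, the edges at v that are lighter than e2 lie in B, so there are fewer than k of them; at the other
    ends fewer than k edges of weight less than t remain, since these ends are
    not saturated. *)
Lemma LKdegree_ge2 x t k v (A := light x t :&: star v)
    (B := saturated (light x t) k v) :
  (1 < #|A :\: B|)%N -> (#|A :&: B|.+1 < k)%N ->
  (1 < #|LKedges x k :&: star v|)%N.
Proof.
move=> AB Bk; set D := A :\: B.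
have goodj e j : e \in D -> j \in val e -> j != v ->
    (#|light x (x e) :&: star j| < k)%N.
  move=> eD je jv; move: (eD); rewrite in_setD => /andP[eB eA].
  move: eA; rewrite !inE => /andP[et ve].
  have : (#|light x t :&: star j :\: star v| < k)%N.
    rewrite ltnNge; apply: contra eB => kj; rewrite !inE ve /=.
    by apply/existsP; exists j; rewrite je jv kj.
  apply: leq_ltn_trans; apply/subset_leq_card/subsetP => f.
  rewrite !inE => /andP[fe jf]; rewrite (lt_trans fe et) jf !andbT.
  apply/negP => vf; have fE : f = e.
    by apply: val_inj; rewrite (edge_ends jv jf vf) (edge_ends jv je ve).
  by rewrite fE ltxx in fe.
have inLK e : e \in D -> (#|light x (x e) :&: star v| < k)%N ->
    e \in LKedges x k :&: star v.
  move=> eD ek; move: (eD); rewrite in_setI in_setD in_setI => /and3P[_ _ ->].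
  rewrite andbT; apply/LKedgesP => j je.
  by have [->//|jv] := eqVneq j v; apply: goodj eD je jv.
have /card_gt0P[e0 e0D] : (0 < #|D|)%N by apply: ltnW.
case: (Order.TotalTheory.arg_minP x e0D) => e1 e1D' min1.
have e1D : e1 \in D by exact: e1D'.
have /card_gt0P[f0 f0D] : (0 < #|D :\ e1|)%N.
  by move: AB; rewrite -/D (cardsD1 e1) e1D.
case: (Order.TotalTheory.arg_minP x f0D) => e2 e2D' min2.
have e2D : e2 \in D :\ e1 by exact: e2D'.
move: (e2D); rewrite in_setD1 => /andP[e21 e2DD].
have lt1 : {subset light x (x e1) :&: star v <= A :&: B}.
  move=> f; rewrite in_setI inE => /andP[fe fv].
  have e1t : x e1 < t by move: e1D; rewrite !inE => /and3P[].
  have fA : f \in A by rewrite in_setI fv inE (lt_trans fe e1t).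
  rewrite in_setI fA /=; apply/negPn/negP => fB.
  have fD : f \in D by rewrite in_setD fB fA.
  by have := min1 f fD; rewrite leNgt fe.
have lt2 : {subset light x (x e2) :&: star v <= e1 |: (A :&: B)}.
  move=> f; rewrite in_setI inE => /andP[fe fv].
  have e2t : x e2 < t by move: e2DD; rewrite !inE => /and3P[].
  have fA : f \in A by rewrite in_setI fv inE (lt_trans fe e2t).
  rewrite in_setU1 in_setI fA /=.
  have [//|fe1 /=] := eqVneq f e1; apply/negPn/negP => fB.
  have fD : f \in D :\ e1 by rewrite in_setD1 in_setD fB fA fe1.
  by have := min2 f fD; rewrite leNgt fe.
have e1L : e1 \in LKedges x k :&: star v.
  apply: inLK => //; apply: leq_ltn_trans (ltnW Bk).
  by apply/subset_leq_card/subsetP.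
have e2L : e2 \in LKedges x k :&: star v.
  apply: inLK => //; apply: leq_ltn_trans Bk.
  apply: leq_trans (subset_leq_card (introT subsetP lt2)) _.
  by rewrite cardsU1; case: (_ \notin _).
rewrite (cardsD1 e1) e1L (cardsD1 e2) in_setD1 e21 e2L.
by [].
Qed.

(** An edge among the k lightest ones at v is lighter than q but not lighter than
    p, so at its other end at least k edges precede it. *)
Lemma isolated_LK x p q k v :
  light x p :&: star v = finset.set0 -> (k <= #|light x q :&: star v|)%N ->
  (forall e j, e \in star v -> (x e < q)%R -> j \in val e -> j != v ->
     (k <= #|light x p :&: star j :\: star v|)%N) ->
  LKedges x k :&: star v = finset.set0.
Proof.
move=> pv kq sat; apply/setP => e; rewrite in_setI [RHS]inE.
apply/negP => /andP[eL ev]; move: (ev); rewrite in_star => ve.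
have := LKedges_light kq ve eL; rewrite inE => eq.
have [j jv ee] := edge_other ve.
have je : j \in val e by rewrite ee !inE eqxx orbT.
have /LKedgesP/(_ j je) := eL; rewrite ltnNge => /negP; apply.
apply: leq_trans (sat e j ev eq je jv) _.
apply/subset_leq_card/subsetP => f; rewrite !inE => /and3P[_ fp ->].
rewrite andbT (lt_le_trans fp) // leNgt; apply/negP => ep.
by have /setP/(_ e) := pv; rewrite !inE ep ve.
Qed.

Lemma isolated_not_connected x k v : (1 < n)%N ->
  LKedges x k :&: star v = finset.set0 -> ~ graph_connected (LK x k).
Proof.
move=> n1 v0 conn; have /card_gt0P[j] : (0 < #|~: [set v]|)%N.
  by rewrite cardsC1 card_ord -ltnS prednK // ltnW.
rewrite !inE => jv; have /connectP[p] := conn v j.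
case: p => [|u p] /=; first by move=> _ jE; rewrite jE eqxx in jv.
move=> /andP[/LK_edge[e ee eL] _] _; have /setP/(_ e) := v0.
by rewrite in_setI eL in_star ee !inE eqxx.
Qed.

(** A component of at most half of the vertices is such a set: no edge of LK
    leaves it, and counting the at least two edges of LK at each of its vertices
    gives at least as many edges as vertices inside. *)
Lemma disconnected_sparse_cut x t0 t2 k :
  light x t0 \subset LKedges x k -> LKedges x k \subset light x t2 ->
  (forall v, (1 < #|LKedges x k :&: star v|)%N) -> ~ graph_connected (LK x k) ->
  exists S, [/\ (0 < #|S|)%N, (#|S|.*2 <= n)%N,
    light x t0 :&: crossing S = finset.set0 & (#|S| <= #|light x t2 :&: inside S|)%N].
Proof.
move=> t0L Lt2 deg2 nconn.
have [i [j /negP nij]] : exists i j, ~ connect (LK x k) i j.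
  by move/existsNP: nconn => [i /existsNP[j ?]]; exists i, j.
have csym : connect_sym (LK x k) by apply/sym_connect_sym/LK_sym.
(* Two disjoint components exist, and the smaller one has at most n / 2 vertices. *)
pose comp u : {set 'I_n} := [set w | connect (LK x k) u w].
have dij : [disjoint comp i & comp j].
  apply/pred0P => w /=; rewrite !inE; apply/negP => /andP[iw jw].
  by move/negP: nij; apply; apply: connect_trans iw _; rewrite csym.
have [u hu] : exists u, (#|comp u|.*2 <= n)%N.
  have : (#|comp i| + #|comp j| <= n)%N.
    rewrite -cardsUI; have -> : comp i :&: comp j = finset.set0.
      by apply/eqP; rewrite setI_eq0.
    by rewrite cards0 addn0 -[X in (_ <= X)%N]card_ord max_card.
  case: (leqP #|comp i| #|comp j|) => h1 h2; [exists i|exists j]; lia.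
have inLK e w w' : e \in LKedges x k -> w \in val e -> w' \in val e ->
    w \in comp u -> w' \in comp u.
  move=> eL we w'e; rewrite !inE => uw; have [->//|ww'] := eqVneq w' w.
  apply: connect_trans uw _; apply: connect1; apply/LK_edge; exists e => //.
  by apply: edge_ends; rewrite // eq_sym.
exists (comp u); split => //.
- by apply/card_gt0P; exists u; rewrite inE connect0.
- apply/setP => e; rewrite in_setI [RHS]inE; apply/negP => /andP[/(subsetP t0L) eL].
  rewrite inE => /andP[/pred0Pn[w /= /andP[we wu]] /subsetPn[w' w'e]].
  by rewrite (inLK e w w').
rewrite -leq_double -handshake -muln2 -sum_nat_const.
rewrite [X in (X <= _)%N]big_mkcond /=; apply: leq_sum => w _.
case: ifP => // wu; apply: leq_trans (deg2 w) _.
apply/subset_leq_card/subsetP => e; rewrite in_setI in_star => /andP[eL we].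
rewrite !in_setI (subsetP Lt2) //= in_star we andbT inE.
by apply/subsetP => w' w'e; apply: inLK eL we w'e wu.
Qed.

End Deterministic.

(** * From i.i.d. uniform weights to a product law on four classes *)

Section FiniteRange.
Local Open Scope classical_set_scope.
Local Open Scope ring_scope.
Context {d : measure_display} {T : measurableType d}.

(** The event is the union of the finitely many fibers that it meets. *)
Lemma measurable_finite_range (I : finType) (D : T -> I) (A : set T) :
  (forall c, measurable (D @^-1` [set c])) ->
  (forall w w', D w = D w' -> A w -> A w') -> measurable A.
Proof.
move=> mD AD.
have -> : A = \bigcup_(c in [set c | exists2 w, A w & D w = c]) D @^-1` [set c].
  apply/seteqP; split=> [w Aw|w [c [w' Aw' <-]] /esym/AD]; last exact.
  by exists (D w) => //; exists w.
by apply: fin_bigcup_measurable => // c _; exact: mD.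
Qed.

Lemma measurable_ffun_fiber (I K : finType) (D : I -> T -> K) (c : {ffun I -> K}) :
  (forall i k, measurable (D i @^-1` [set k])) ->
  measurable ((fun w => [ffun i => D i w]) @^-1` [set c]).
Proof.
move=> mD; have -> : (fun w => [ffun i => D i w]) @^-1` [set c] =
    \bigcap_(i in [set: I]) D i @^-1` [set c i].
  apply/seteqP; split=> [w /= <- i _|w h]; first by rewrite /= ffunE.
  by apply/ffunP => i; rewrite ffunE; exact: h.
by apply: fin_bigcap_measurable => // i _; exact: mD.
Qed.

End FiniteRange.

Section ThresholdClasses.
Local Open Scope classical_set_scope.
Local Open Scope ring_scope.
Context {R : realType}.
Variables t0 t1 t2 : R.
Hypothesis t0_ge0 : 0 <= t0.
Hypothesis t01 : t0 <= t1.
Hypothesis t12 : t1 <= t2.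
Hypothesis t2_le1 : t2 <= 1.

Definition wclass (r : R) : 'I_4 :=
  if r < t0 then inord 0 else if r < t1 then inord 1 else
  if r < t2 then inord 2 else inord 3.

Definition pclass (c : 'I_4) : R := [:: t0; t1 - t0; t2 - t1; 1 - t2]`_c.

Lemma pclass_ge0 c : 0 <= pclass c.
Proof. by case: c => -[|[|[|[|//]]]] ?; rewrite /pclass /= ?subr_ge0. Qed.

Lemma pclass_sum1 : \sum_c pclass c = 1.
Proof. rewrite !big_ord_recl big_ord0 /pclass /=; ring. Qed.

Definition below (i : nat) : pred 'I_4 := fun c => (c <= i)%N.

Lemma mass_below0 : mass pclass (below 0) = t0.
Proof.
by rewrite /mass big_mkcond !big_ord_recl big_ord0 /pclass /below /= !addr0.
Qed.
Lemma mass_below1 : mass pclass (below 1) = t1.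
Proof.
rewrite /mass big_mkcond !big_ord_recl big_ord0 /pclass /below /=; ring.
Qed.
Lemma mass_below2 : mass pclass (below 2) = t2.
Proof.
rewrite /mass big_mkcond !big_ord_recl big_ord0 /pclass /below /=; ring.
Qed.

Lemma below0E r : below 0 (wclass r) = (r < t0).
Proof.
rewrite /below /wclass; case: ifPn => h; first by rewrite inordK.
by do 2?[case: ifPn => _]; rewrite inordK.
Qed.
Lemma below1E r : below 1 (wclass r) = (r < t1).
Proof.
rewrite /below /wclass; case: ifPn => h.
  by rewrite inordK // (lt_le_trans h).
by case: ifPn => ?; rewrite ?inordK //; case: ifPn; rewrite inordK.
Qed.
Lemma below2E r : below 2 (wclass r) = (r < t2).
Proof.
rewrite /below /wclass; case: ifPn => h.
  by rewrite inordK // (lt_le_trans h) // (le_trans t01).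
case: ifPn => h1; first by rewrite inordK // (lt_le_trans h1).
by case: ifPn => ?; rewrite ?inordK.
Qed.

Lemma wclass_preim c : exists i : interval R, wclass @^-1` [set c] = [set` i] /\
  lebesgue_measure ([set` i] `&` `[0, 1]) = (pclass c)%:E.
Proof.
move: (t0_ge0) (t01) (t12) (t2_le1) => h0 h01 h12 h21.
have E (a b : itv_bound R) (A : set R) (u v : R) : A `&` `[0, 1] = [set` Interval a b] ->
    ((a : \bar R) = u%:E) -> ((b : \bar R) = v%:E) -> u <= v ->
    lebesgue_measure (A `&` `[0, 1]) = (v - u)%:E.
  move=> -> au bv uv; rewrite lebesgue_measure_itv /= au bv lte_fin; case: ifPn => //.
  by rewrite -leNgt => vu; congr EFin; apply/eqP; rewrite eq_sym subr_eq0 eq_le uv vu.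
have val_inord k (kl : (k < 4)%N) (kc : (k < 4)%N) : (inord k : 'I_4) = Ordinal kc.
  by apply: val_inj; rewrite /= inordK.
case: c => -[|[|[|[|//]]]] h; rewrite /pclass /=.
- exists `]-oo, t0[; split.
    apply/seteqP; split => r; rewrite /= in_itv /= /wclass.
      by case: ifPn => // r0; do 2?[case: ifPn => _]; move/(congr1 val); rewrite /= inordK.
    by move=> ->; rewrite val_inord.
  rewrite -[t0 in RHS]subr0; apply: (E (BLeft 0) (BLeft t0)) => //.
  by apply/seteqP; split => r /=; rewrite !in_itv /= ?andbT => ?; try split; lra.
- exists `[t0, t1[; split.
    apply/seteqP; split => r; rewrite /= in_itv /= /wclass.
      do 2?[case: ltP => ? //=]; last case: ifP => _; by move/(congr1 val); rewrite /= inordK.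
    by case/andP => a b; rewrite ltNge a /= b val_inord.
  apply: (E (BLeft t0) (BLeft t1)) => //.
  by apply/seteqP; split => r /=; rewrite !in_itv /= ?andbT => ?; try split; lra.
- exists `[t1, t2[; split.
    apply/seteqP; split => r; rewrite /= in_itv /= /wclass.
      do 3?[case: ltP => ? //=]; by move/(congr1 val); rewrite /= inordK.
    by case/andP => a b; rewrite !ltNge (le_trans h01 a) a /= -ltNge b val_inord.
  apply: (E (BLeft t1) (BLeft t2)) => //.
  by apply/seteqP; split => r /=; rewrite !in_itv /= ?andbT => ?; try split; lra.
- exists `[t2, +oo[; split.
    apply/seteqP; split => r; rewrite /= in_itv /= /wclass.
      do 3?[case: ltP => ? //=]; by move/(congr1 val); rewrite /= inordK.
    rewrite andbT => a.
    by rewrite !ltNge (le_trans h01 (le_trans h12 a)) (le_trans h12 a) a /= val_inord.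
  apply: (E (BLeft t2) (BRight 1)) => //.
  by apply/seteqP; split => r /=; rewrite !in_itv /= ?andbT => ?; try split; lra.
Qed.

Lemma measurable_wclass c : measurable (wclass @^-1` [set c]).
Proof. by have [i [-> _]] := wclass_preim c; exact: measurable_itv. Qed.

Lemma uniform_wclass c :
  uniform_prob (@ltr01 R) (wclass @^-1` [set c]) = (pclass c)%:E.
Proof.
have [i [-> <-]] := wclass_preim c.
rewrite /uniform_prob integral_uniform_pdf.
rewrite (eq_integral (cst 1%:E)).
  by rewrite integral_cst ?mul1e //; apply: measurableI; exact: measurable_itv.
move=> r; rewrite inE => -[_ /=]; rewrite in_itv /= /uniform_pdf => ->.
by rewrite subr0 invr1.
Qed.

Context {d : measure_display} {T : measurableType d}.
Variables (P : probability T R) (I : finType) (X : I -> {RV P >-> R}).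
Hypothesis iidX : iid_uniform01 X.

Definition wclasses (w : T) : {ffun I -> 'I_4} := [ffun i => wclass (X i w)].

Lemma measurable_wclass_RV i c : measurable ((fun w => wclass (X i w)) @^-1` [set c]).
Proof.
rewrite -[X in measurable X]setTI.
have -> : (fun w => wclass (X i w)) @^-1` [set c] = X i @^-1` (wclass @^-1` [set c]) by [].
exact: measurable_funP (measurable_wclass c).
Qed.

Lemma prob_wclasses1 c :
  P (wclasses @^-1` [set c]) = (pmf pclass c)%:E.
Proof.
have [indep unif] := iidX.
have -> : wclasses @^-1` [set c] =
    [set w | forall i, i \in [set: I]%SET -> (wclass @^-1` [set c i]) (X i w)].
  apply/seteqP; split => w /=; first by move=> <- i _; rewrite ffunE.
  by move=> h; apply/ffunP => i; rewrite ffunE; apply: h; rewrite inE.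
rewrite (indep [set: I]%SET (fun i => wclass @^-1` [set c i])); last first.
  by move=> i _; exact: measurable_wclass.
rewrite /pmf -prodEFin; apply: eq_big => [i|i _]; first by rewrite inE.
by rewrite -uniform_wclass -(unif i) //; exact: measurable_wclass.
Qed.

Lemma prob_wclasses (Q : pred {ffun I -> 'I_4}) :
  P [set w | Q (wclasses w)] = (Pr pclass Q)%:E.
Proof.
have -> : [set w | Q (wclasses w)] =
    \bigcup_(c in [set` enum Q]) wclasses @^-1` [set c].
  apply/seteqP; split => [w /= Qw|w /= [c /=]].
    by exists (wclasses w); rewrite //= mem_enum.
  by rewrite mem_enum => Qc ->.
rewrite measure_fin_bigcup //.
- rewrite -fsbig_seq ?enum_uniq // big_enum_cond /= /Pr /Ex -sumEFin.
  rewrite [LHS]big_mkcond; apply: eq_bigr => c _ /=.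
  rewrite -topredE /= prob_wclasses1.
  by case: (Q c); rewrite /= ?mulr1 ?mulr0.
- by move=> c c' _ _ [w [/= <- <-]].
- move=> c _; apply: measurable_ffun_fiber => i k; exact: measurable_wclass_RV.
Qed.

(** The pattern of comparisons between the weights takes finitely many values. *)
Lemma measurable_order_event (A : set T) :
  (forall w w', (forall i j, (X i w < X j w) = (X i w' < X j w')) -> A w -> A w') ->
  measurable A.
Proof.
move=> AX.
apply: (@measurable_finite_range _ _ _
  (fun w => [ffun ij : I * I => X ij.1 w < X ij.2 w])) => [c|w w' E].
  apply: measurable_ffun_fiber => -[i j] b /=.
  rewrite -[X in measurable X]setTI.
  have /(_ measurableT [set b]) := @measurable_realfun.measurable_fun_ltr _ _ _ setT (X i) (X j)
    (measurable_funP (X i)) (measurable_funP (X j)).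
  by apply.
by apply: AX => i j; move/ffunP/(_ (i, j)): E; rewrite !ffunE.
Qed.

End ThresholdClasses.

(** * Probability bounds at fixed thresholds *)

Section Bounds.
Import fintype boot.finset.
Context {R : realType} {n : nat}.
Variables t0 t1 t2 : R.
Hypothesis t0_ge0 : 0 <= t0.
Hypothesis t01 : t0 <= t1.
Hypothesis t12 : t1 <= t2.
Hypothesis t2_le1 : t2 <= 1.
Implicit Types (x y : {ffun edge n -> 'I_4}) (k b : nat) (e f : edge n).
Implicit Types (v i j : 'I_n) (S : {set 'I_n}) (A G : {set edge n}).

Let m := pclass t0 t1 t2.
Let m_ge0 : forall c, 0 <= m c := pclass_ge0 t0_ge0 t01 t12 t2_le1.
Let m_sum1 : \sum_c m c = 1 := pclass_sum1 t0 t1 t2.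
Let N := n.-1.

Definition lightc a x : {set edge n} := [set e : edge n | below a (x e)].

Lemma occ_lightc A a x : occ A (below a) x = #|lightc a x :&: A|.
Proof. by rewrite /occ; apply: eq_card => e; rewrite !inE andbC. Qed.

Lemma card_lightc_ge_tail A a (z : R) k : 1 <= z ->
  Pr m (fun x => (k <= #|lightc a x :&: A|)%N) <=
  z ^- k * (1 - mass m (below a) * (1 - z)) ^+ #|A|.
Proof.
move=> z1; apply: le_trans (occ_ge_tail m_ge0 m_sum1 A (below a) k z1).
by apply: Pr_sub => // x; rewrite occ_lightc.
Qed.

Lemma card_lightc_le_tail A a (z : R) k : 0 < z <= 1 ->
  Pr m (fun x => (#|lightc a x :&: A| <= k)%N) <=
  z ^- k * (1 - mass m (below a) * (1 - z)) ^+ #|A|.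
Proof.
move=> z1; apply: le_trans (occ_le_tail m_ge0 m_sum1 A (below a) k z1).
by apply: Pr_sub => // x; rewrite occ_lightc.
Qed.

Lemma mass_nbelow0 : \sum_c m c * (~~ below 0 c)%:R = 1 - t0.
Proof.
rewrite -(mass_below0 t0 t1 t2) -mass_indic -[X in X - _]m_sum1 -sumrB; apply: eq_bigr => c _.
by case: (below 0 c); rewrite /= ?mulr0 ?mulr1 ?subrr ?subr0.
Qed.

Section Disconnected.
Variable k : nat.

Definition isolated v x := lightc 0 x :&: star v == finset.set0.
Definition few v x := isolated v x && (#|lightc 1 x :&: star v| < k)%N.
Definition spoilt v e x := [&& isolated v x, below 1 (x e) &
  [exists j in val e, (j != v) && (#|lightc 0 x :&: star j :\: star v| < k)%N]].
(** A doomed vertex is isolated in LK, see [isolated_LK]. *)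
Definition doomed v x := [&& isolated v x, ~~ few v x &
  [forall e in star v, ~~ spoilt v e x]].

Lemma isolatedE v x :
  (isolated v x)%:R = \prod_(e in star v) (~~ below 0 (x e))%:R :> R.
Proof.
rewrite (prod_indic R (star v) (predC (below 0)) x) /isolated; congr (_%:R); congr nat_of_bool.
apply/eqP/forall_inP => [/setP h e ev|h].
  by have := h e; rewrite !inE -in_star ev andbT => /= ->.
by apply/setP => e; rewrite in_setI [RHS]inE inE; apply/negP => /andP[eb /h /=]; rewrite eb.
Qed.

Lemma Ex_isolated v : Ex m (fun x => (isolated v x)%:R) = (1 - t0) ^+ N.
Proof.
rewrite -mass_nbelow0 /N -(card_star v) -(Ex_prod1 m_sum1); apply: eq_bigr => x _.
by rewrite isolatedE.
Qed.

(** The stars of i and j share at most one edge, so the two events are almost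
    independent. *)
Lemma Ex_isolated2 i j : i != j ->
  Ex m (fun x => (isolated i x)%:R * (isolated j x)%:R) <= (1 - t0) ^+ (N + N).-1.
Proof.
move=> ij; have t0' : 0 <= 1 - t0 <= 1 by move: t0_ge0 t01 t12 t2_le1; lra.
apply: (@le_trans _ _ ((1 - t0) ^+ #|star i :|: star j|)).
  rewrite -mass_nbelow0 -(Ex_prod1 m_sum1); apply: le_Ex => // x.
  rewrite !isolatedE (prod_indic R _ (predC (below 0))) (prod_indic R _ (predC (below 0))).
  rewrite (prod_indic R _ (predC (below 0))) -natrM mulnb ler_nat.
  case: forall_inP => // h1; case: forall_inP => // h2.
  rewrite (introT forall_inP) // => e; rewrite inE => /orP[]; [exact: h1|exact: h2].
apply: ler_wiXn2l; [by case/andP: t0'..|].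
have := cardsUI (star i) (star j); have := card_starI ij; rewrite !card_star -/N; lia.
Qed.

(** Markov's inequality for (1/2) ^+ d on the event that v is isolated, where d is
    the number of edges at v of weight less than t1. *)
Lemma few_bound v :
  Ex m (fun x => (few v x)%:R) <= 2 ^+ k * (1 - t1 + (t1 - t0) / 2) ^+ N.
Proof.
pose g (c : 'I_4) : R := (~~ below 0 c)%:R * (if below 1 c then 2^-1 else 1).
have -> : 1 - t1 + (t1 - t0) / 2 = \sum_c m c * g c.
  rewrite !big_ord_recl big_ord0 /m /pclass /g /below /=; ring.
rewrite /N -(card_star v) -(Ex_prod1 m_sum1) -Ex_scale; apply: le_Ex => // x.
rewrite big_split /= -isolatedE (prod_occ (star v) (below 1)) occ_lightc /few.
case: (isolated v x) => /=; last by rewrite mul0r mulr0.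
rewrite mul1r; case: ltnP => h; last by rewrite mulr_ge0 ?exprn_ge0 ?invr_ge0.
by rewrite exprVn ler_pdivlMr ?exprn_gt0 // mul1r; apply: ler_weXn2l; rewrite ?ler1n // ltnW.
Qed.

(** The three events that v has no other edge lighter than t0, that e has a weight
    between t0 and t1, and that its other end has fewer than k light edges apart
    from e, concern disjoint sets of edges. *)
Lemma spoilt_bound v e (z : R) : e \in star v -> 0 < z <= 1 ->
  Ex m (fun x => (spoilt v e x)%:R) <=
  (1 - t0) ^+ N.-1 * (t1 - t0) * (z ^- k * (1 - t0 * (1 - z)) ^+ N.-1).
Proof.
move=> ev z01; have := ev; rewrite in_star => /edge_other[j jv ee].
have jc : j \in val e by rewrite ee !inE eqxx orbT.
pose h (c : 'I_4) : R := if below 0 c then z else 1.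
pose g (c : 'I_4) : R := (below 1 c && ~~ below 0 c)%:R.
pose f (c : 'I_4) : R := (~~ below 0 c)%:R.
have t0' : 0 <= t0 <= 1 by move: t0_ge0 t01 t12 t2_le1; lra.
have t1' : 0 <= t1 - t0 by move: t01; lra.
have hE : \sum_c m c * h c = 1 - t0 * (1 - z).
  by rewrite -(mass_below0 t0 t1 t2) -mass_pgf.
have gE : \sum_c m c * g c = t1 - t0.
  rewrite !big_ord_recl big_ord0 /m /pclass /g /below /=; ring.
have h01 : 0 <= 1 - t0 * (1 - z) <= 1 by nra.
pose C := star j :\: star v.
apply: (@le_trans _ _ ((1 - t0) ^+ N.-1 * (t1 - t0) * (z ^- k * (1 - t0 * (1 - z)) ^+ #|C|))).
  have cA : N.-1 = #|star v :\ e| by rewrite /N -(card_star v) (cardsD1 e) ev.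
  rewrite mulrCA cA -{1}mass_nbelow0 -hE.
  have -> : t1 - t0 = (\sum_c m c * g c) ^+ #|[set e]| by rewrite cards1 expr1 gE.
  rewrite -/f.
  rewrite -(Ex_prod3 m_sum1 f g h); last 3 first.
  - by rewrite disjoint_sym disjoints1 !inE eqxx.
  - by rewrite disjoint_sym disjoint_subset; apply/subsetP => u; rewrite !inE => /andP[/negPf->]; rewrite andbF.
  - by rewrite disjoints1 !inE -in_star ev.
  rewrite -Ex_scale; apply: le_Ex => // x.
  have z0 : 0 < z by case/andP: z01.
  rewrite big_set1.
  have -> : \prod_(i in C) h (x i) = z ^+ #|lightc 0 x :&: C|.
    by rewrite -occ_lightc -prod_occ.
  have : 0 <= z ^- k * ((\prod_(u in star v :\ e) f (x u)) * g (x e) *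
      z ^+ #|lightc 0 x :&: C|).
    apply: mulr_ge0; first by rewrite invr_ge0 exprn_ge0 ?ltW.
    apply: mulr_ge0; last by rewrite exprn_ge0 ?ltW.
    by apply: mulr_ge0 => //; apply: prodr_ge0.
  case: (boolP (spoilt v e x)) => // /and3P[iso b1 /existsP[j' /and3P[j'e j'v lek]]] _.
  have {j'e j'v} j'j : j' = j.
    by move: j'e j'v; rewrite ee !inE => /orP[]/eqP-> //; rewrite eqxx.
  rewrite {}j'j in lek.
  have isoE : isolated v x = true by [].
  move: (isolatedE v x); rewrite isoE /= (bigD1 e) //=.
  case: (boolP (below 0 (x e))) => [_|nb0]; first by rewrite mul0r => /eqP; rewrite pnatr_eq0.
  rewrite mul1r => E; rewrite (eq_bigl (fun u => (u \in star v) && (u != e))); last first.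
    by move=> u; rewrite in_setD1 andbC.
  rewrite -E mul1r /g b1 nb0 /= mul1r ler_pdivlMl ?exprn_gt0 // mulr1.
  by apply: ler_wiXn2l; rewrite ?(ltW z0) ?(andP z01).2 // /C setIDA ltnW.
have cC : (N.-1 <= #|C|)%N.
  have := cardsID (star v) (star j); have := card_starI jv; rewrite !card_star -/N -/C.
  by move=> u1 <-; rewrite -subn1 leq_subLR leq_add2r.
case/andP: z01 => z0 z1.
rewrite ler_wpM2l ?mulr_ge0 ?exprn_ge0 //; first by lra.
rewrite ler_wpM2l ?invr_ge0 ?exprn_ge0 ?(ltW z0) //.
by apply: ler_wiXn2l => //; case/andP: h01.
Qed.

Hypothesis n_gt1 : (1 < n)%N.
Hypothesis t0_lt1 : t0 < 1.

Let a : R := (1 - t0) ^+ N.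
Let M : R := n%:R * a.

Let n_gt0 : 0 < n%:R :> R. Proof. by rewrite ltr0n ltnW. Qed.
Let N_gt0 : (0 < N)%N. Proof. by rewrite /N -ltnS prednK // ltnW. Qed.
Let aE : a = (1 - t0) ^+ N.-1 * (1 - t0).
Proof. by rewrite -exprSr prednK. Qed.
Let a_gt0 : 0 < a. Proof. by rewrite exprn_gt0 // subr_gt0. Qed.
Let M_gt0 : 0 < M. Proof. exact: mulr_gt0. Qed.

Lemma Ex_isolated_sq :
  Ex m (fun x => (\sum_v (isolated v x)%:R) ^+ 2) <= M + M ^+ 2 / (1 - t0).
Proof.
have -> : Ex m (fun x => (\sum_v (isolated v x)%:R) ^+ 2) =
    \sum_i \sum_j Ex m (fun x => (isolated i x)%:R * (isolated j x)%:R).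
  under [RHS]eq_bigr => i _ do rewrite -Ex_sum.
  rewrite -Ex_sum; apply: eq_bigr => x _; congr (_ * _).
  by rewrite expr2 mulr_suml; apply: eq_bigr => i _; rewrite mulr_sumr.
have a2 : 0 <= a ^+ 2 / (1 - t0) by rewrite divr_ge0 ?exprn_ge0 ?subr_ge0 ?ltW.
have a2E : (1 - t0) ^+ (N + N).-1 = a ^+ 2 / (1 - t0).
  have -> : (N + N).-1 = (N.-1 + N)%N by move: N_gt0; case: (N).
  rewrite exprD -/a expr2 mulrAC; congr (_ * _).
  by rewrite aE mulfK // subr_eq0 gt_eqF.
have -> : M + M ^+ 2 / (1 - t0) =
    \sum_(i < n) (a + \sum_(j < n) a ^+ 2 / (1 - t0)).
  rewrite !sumr_const !card_ord -[in RHS](mulr_natl _ n) -[_ / _ *+ n]mulr_natl /M.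
  by move: (n%:R : R) (a) (1 - t0) => u v w; ring.
apply: ler_sum => i _; rewrite (bigD1 i) //= lerD //.
  rewrite /a -(Ex_isolated i); apply: le_Ex => // x.
  by case: (isolated i x); rewrite ?mulr0 ?mulr1.
rewrite [X in _ <= X](bigD1 i) //= -[X in X <= _]add0r lerD //.
apply: ler_sum => j ji; rewrite -a2E; apply: Ex_isolated2.
by rewrite eq_sym.
Qed.

(** Each isolated vertex that is not doomed is counted by the sum Y of the
    indicators of few and spoilt, so if there is no doomed vertex then either
    the number X of isolated vertices deviates from its mean M by at least M / 2
    (Chebyshev), or Y is at least M / 2 (Markov). *)
Lemma no_doomed_bound (z : R) : 0 < z <= 1 ->
  Pr m (fun x => [forall v, ~~ doomed v x]) <=
  4 / M + 4 * (t0 / (1 - t0)) +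
  2 * (2 ^+ k * (1 - (t1 - t0) / 2) ^+ N +
       N%:R * ((t1 - t0) / (1 - t0)) * (z ^- k * (1 - t0 * (1 - z)) ^+ N.-1)).
Proof.
move=> z01; set D1 := 2 ^+ k * _; set D2 := N%:R * _ * _.
have u0 : 0 < 1 - t0 by rewrite subr_gt0.
pose X x : R := \sum_v (isolated v x)%:R.
pose Y x : R := \sum_v ((few v x)%:R + \sum_(e in star v) (spoilt v e x)%:R).
have Y0 x : 0 <= Y x.
  by apply: sumr_ge0 => v _; apply: addr_ge0 => //; apply: sumr_ge0.
have EX : Ex m X = M.
  rewrite /X Ex_sum; under eq_bigr => v _ do rewrite Ex_isolated.
  by rewrite sumr_const card_ord /M mulr_natl.
have EY : Ex m Y <= M * (D1 + D2).
  have -> : M * (D1 + D2) = \sum_(v < n) (a * D1 + \sum_(e in star v) a * D2 / N%:R).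
    have N0 : N%:R != 0 :> R by rewrite pnatr_eq0 -lt0n.
    have -> : \sum_(v < n) (a * D1 + \sum_(e in star v) a * D2 / N%:R) =
        \sum_(v < n) (a * (D1 + D2)).
      apply: eq_bigr => v _; rewrite sumr_const card_star -/N -mulr_natl; field.
      exact: N0.
    by rewrite sumr_const card_ord /M -[RHS]mulr_natl mulrA.
  rewrite /Y Ex_sum; apply: ler_sum => v _; rewrite ExD lerD //.
    apply: le_trans (few_bound v) _; rewrite mulrCA ler_wpM2l ?exprn_ge0 //.
    rewrite /a -exprMn lerXn2r ?nnegrE //.
    - by move: t0_ge0 t01 t12 t2_le1; lra.
    - by rewrite mulr_ge0 ?(ltW u0) //; move: t0_ge0 t01 t12 t2_le1; lra.
    - by move: t0_ge0 t01 t12 t2_le1; nra.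
  rewrite Ex_sum; apply: ler_sum => e ev.
  apply: le_trans (spoilt_bound ev z01) _; rewrite le_eqVlt; apply/orP; left; apply/eqP.
  have N0 : N%:R != 0 :> R by rewrite pnatr_eq0 -lt0n.
  rewrite aE /D2; move: ((1 - t0) ^+ N.-1) (z ^- k * _) => u w.
  by field; rewrite N0 gt_eqF.
(* The first summand is at least 1 if Y < M / 2, since then X <= Y < M / 2, and the
   second one if Y >= M / 2. *)
apply: (@le_trans _ _ (Ex m (fun x => 4 / M ^+ 2 * (X x - M) ^+ 2 + 2 / M * Y x))).
  apply: Pr_le_Ex => // x.
    by rewrite addr_ge0 // mulr_ge0 ?sqr_ge0 ?divr_ge0 ?sqr_ge0 ?(ltW M_gt0).
  move=> /forallP nd.
  have XY : X x <= Y x.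
    apply: ler_sum => v _; have := nd v; rewrite /doomed.
    case: (isolated v x) => /= [|_]; last by rewrite addr_ge0 // sumr_ge0.
    rewrite negb_and negbK; case: (few v x) => /= [_|].
      by rewrite lerDl sumr_ge0.
    rewrite add0r negb_forall => /existsP[e]; rewrite negb_imply negbK => /andP[ev se].
    by rewrite (bigD1 e) //= se lerDl sumr_ge0.
  have [YM|YM] := leP (M / 2) (Y x).
    apply: (@le_trans _ _ (2 / M * Y x)).
      rewrite -ler_pdivrMl ?divr_gt0 // mulr1 invf_div //.
    by rewrite lerDr mulr_ge0 ?sqr_ge0 ?divr_ge0 ?sqr_ge0 ?(ltW M_gt0).
  apply: (@le_trans _ _ (4 / M ^+ 2 * (X x - M) ^+ 2)).
    have M2 : 0 < M ^+ 2 by rewrite exprn_gt0.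
    rewrite -ler_pdivrMl ?divr_gt0 // mulr1 invf_div.
    rewrite ler_pdivrMr //.
    have h1 : 0 <= M - X x - M / 2 by lra.
    have h2 : 0 <= M - X x + M / 2 by move: M_gt0; lra.
    by have := mulr_ge0 h1 h2; nra.
  by rewrite lerDl mulr_ge0 ?divr_ge0 ?(ltW M_gt0).
rewrite ExD !Ex_scale lerD //; last first.
  by rewrite -mulrA ler_pM2l // -ler_pdivlMl ?invr_gt0 // invrK.
have -> : Ex m (fun x => (X x - M) ^+ 2) = Ex m (fun x => X x ^+ 2) - M ^+ 2.
  have -> : Ex m (fun x => (X x - M) ^+ 2) =
      Ex m (fun x => X x ^+ 2 + ((- 2 * M) * X x + M ^+ 2 * 1)).
    by apply: eq_bigr => x _; congr (_ * _); ring.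
  by rewrite !ExD !Ex_scale (Ex1 _ m_sum1) // EX; ring.
have := Ex_isolated_sq; set E := Ex m _ => hE.
apply: (@le_trans _ _ (4 / M ^+ 2 * (M + M ^+ 2 / (1 - t0) - M ^+ 2))).
  by rewrite ler_wpM2l ?divr_ge0 ?sqr_ge0 // lerB.
rewrite le_eqVlt; apply/orP; left; apply/eqP.
by field; rewrite !gt_eqF.
Qed.

End Disconnected.


Section Connected.
Variables (k b : nat).

Definition sat v x := saturated (lightc 1 x) k v.
(** For every v, the number of crowded vertices bounds the size of sat v, which
    makes a single event control the sets sat v for all v. *)
Definition crowded x := [set j | (k <= #|lightc 1 x :&: star j|)%N].
(** Together with choked, the two ways in which the hypotheses of [LKdegree_ge2]
    can fail at v when sat v is small. *)
Definition starved v x := (#|sat v x| <= b)%N &&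
  (#|(lightc 1 x :&: star v) :\: sat v x| <= 1)%N.
Definition choked v x := (#|sat v x| <= b)%N &&
  (k.-1 <= #|(lightc 1 x :&: star v) :&: sat v x|)%N.
Definition sparse_cut S x := [&& (0 < #|S|)%N && (#|S|.*2 <= n)%N,
  lightc 0 x :&: crossing S == finset.set0 & (#|S| <= #|lightc 2 x :&: inside S|)%N].

Lemma card_sat v x : (#|sat v x| <= #|crowded x|)%N.
Proof.
rewrite -(card_imset (mem (sat v x)) val_inj).
apply: leq_trans (leq_imset_card (fun j => [set v; j]%SET) _).
apply/subset_leq_card/subsetP => _ /imsetP[e + ->]; rewrite !inE => /andP[ve].
move=> /existsP[j /and3P[je jv kj]]; apply/imsetP; exists j.
  by rewrite inE; apply: leq_trans kj _; apply/subset_leq_card/subsetDl.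
by apply: edge_ends; rewrite // eq_sym.
Qed.

Lemma sat_local v x y : {in ~: star v, x =1 y} -> sat v x = sat v y.
Proof.
move=> xy; apply/setP => e; rewrite !inE; congr (_ && _); apply: eq_existsb => j.
congr [&& _, _ & (_ <= _)%N]; apply: eq_card => f; rewrite !inE.
by case: (boolP (v \in val f)) => //= vf; rewrite xy // !inE.
Qed.

Let p := t1.
Let p01 : 0 <= p <= 1. Proof. by move: t0_ge0 t01 t12 t2_le1; rewrite /p; lra. Qed.

Lemma card_lightc1_ge A (z : R) r u : 1 <= z -> (#|A| <= u)%N ->
  Pr m (fun x => (r <= #|lightc 1 x :&: A|)%N) <= z ^- r * (1 - p * (1 - z)) ^+ u.
Proof.
move=> z1 Au; apply: le_trans (card_lightc_ge_tail A 1 r z1) _.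
rewrite mass_below1 ler_wpM2l ?invr_ge0 ?exprn_ge0 ?(le_trans ler01) //.
by apply: ler_weXn2l => //; case/andP: p01 => p0 p1; rewrite -/p; nra.
Qed.

Lemma crowded_bound (z : R) : 1 <= z -> (0 < b)%N ->
  Pr m (fun x => (b < #|crowded x|)%N) <=
  n%:R / b%:R * (z ^- k * (1 - p * (1 - z)) ^+ N).
Proof.
move=> z1 b0; have b0' : 0 < b%:R :> R by rewrite ltr0n.
apply: (@le_trans _ _ (Ex m (fun x => b%:R^-1 * \sum_j (k <= #|lightc 1 x :&: star j|)%N%:R))).
  apply: Pr_le_Ex => // x; first by rewrite mulr_ge0 ?invr_ge0 ?sumr_ge0.
  move=> h; rewrite ler_pdivlMl // mulr1 -natr_sum ler_nat.
  apply: leq_trans (ltnW h) _; rewrite /crowded -sum1_card big_mkcond /=.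
  by apply: leq_sum => j _; rewrite inE; case: (k <= _)%N.
rewrite Ex_scale mulrAC mulrC ler_wpM2r ?invr_ge0 ?(ltW b0') //.
rewrite Ex_sum mulr_natl -[X in _ *+ X]card_ord -sumr_const.
apply: ler_sum => j _; apply: card_lightc1_ge => //.
by rewrite card_star.
Qed.

(** The set sat v is determined by the edges off the star of v, so it may be
    replaced by a fixed set of at most b edges. *)
Lemma starved_bound v (z : R) : 0 < z <= 1 ->
  Pr m (starved v) <= z^-1 * (1 - p * (1 - z)) ^+ (N - b).
Proof.
move=> z01; have z0 : 0 < z by case/andP: z01.
have h01 : 0 <= 1 - p * (1 - z) <= 1 by case/andP: p01 => ? ?; case/andP: z01 => ? ?; nra.
have c0 : 0 <= z^-1 * (1 - p * (1 - z)) ^+ (N - b).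
  by rewrite mulr_ge0 ?invr_ge0 ?exprn_ge0 ?(ltW z0) //; case/andP: h01.
pose Q (B : {set edge n}) x := (#|B| <= b)%N && (#|(lightc 1 x :&: star v) :\: B| <= 1)%N.
apply: (@Pr_decouple _ _ _ _ m_ge0 m_sum1 _ (star v) (sat v) Q) => [||y].
- exact: sat_local.
- move=> B x y xy; congr (_ && (_ <= _)%N); apply: eq_card => f; rewrite !inE.
  by case: (boolP (v \in val f)) => vf; rewrite ?andbF // xy // inE.
move: (sat v y) => B.
apply: (@le_trans _ _ (Pr m (fun x => (#|B| <= b)%N && (#|lightc 1 x :&: (star v :\: B)| <= 1)%N))).
  by apply: Pr_sub => // x; rewrite /Q setIDA.
have [Bb|Bb] := boolP (#|B| <= b)%N; last first.
  rewrite /Pr /Ex big1 // => x _; by rewrite mulr0.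
apply: le_trans (card_lightc_le_tail (star v :\: B) 1 1 z01) _.
rewrite mass_below1 expr1 ler_wpM2l ?invr_ge0 ?(ltW z0) //.
apply: ler_wiXn2l; [by case/andP: h01..|].
rewrite /N -(card_star v) leq_subLR.
have := cardsID B (star v); have : (#|star v :&: B| <= b)%N.
  by apply: leq_trans Bb; apply/subset_leq_card/subsetIr.
by move=> h <-; rewrite leq_add2r.
Qed.

Lemma choked_bound v (z : R) : 1 <= z ->
  Pr m (choked v) <= z ^- k.-1 * (1 - p * (1 - z)) ^+ b.
Proof.
move=> z1; have z0 : 0 < z by apply: lt_le_trans z1.
have h1 : 0 <= 1 - p * (1 - z) by case/andP: p01 => ? ?; nra.
have c0 : 0 <= z ^- k.-1 * (1 - p * (1 - z)) ^+ b.
  by rewrite mulr_ge0 ?invr_ge0 ?exprn_ge0 ?(ltW z0).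
pose Q (B : {set edge n}) x := (#|B| <= b)%N && (k.-1 <= #|(lightc 1 x :&: star v) :&: B|)%N.
apply: (@Pr_decouple _ _ _ _ m_ge0 m_sum1 _ (star v) (sat v) Q) => [||y].
- exact: sat_local.
- move=> B x y xy; congr (_ && (_ <= _)%N); apply: eq_card => f; rewrite !inE.
  by case: (boolP (v \in val f)) => vf; rewrite ?andbF // xy // inE.
move: (sat v y) => B.
have [Bb|Bb] := boolP (#|B| <= b)%N; last first.
  rewrite /Pr /Ex big1 // => x _; by rewrite /Q (negPf Bb) mulr0.
apply: (@le_trans _ _ (Pr m (fun x => (k.-1 <= #|lightc 1 x :&: (star v :&: B)|)%N))).
  by apply: Pr_sub => // x; rewrite /Q setIA => /andP[].
apply: card_lightc1_ge => //; apply: leq_trans Bb.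
exact/subset_leq_card/subsetIr.
Qed.

(** The inner and the crossing edges of S are disjoint, which makes the absence of
    light crossing edges independent of the count of inner ones. *)
Lemma sparse_cut_bound S (z : R) (r := #|S|) : 1 <= z ->
  Pr m (sparse_cut S) <=
  z ^- r * (1 - t2 * (1 - z)) ^+ (r * r) * (1 - t0) ^+ (r * (n - r)).
Proof.
move=> z1; have z0 : 0 < z by apply: lt_le_trans z1.
have t2_ge0 : 0 <= t2 by move: t0_ge0 t01 t12; lra.
have t0_01 : 0 <= 1 - t0 <= 1 by move: t0_ge0 t01 t12 t2_le1; lra.
have h1 : 1 <= 1 - t2 * (1 - z) by nra.
pose g (c : 'I_4) : R := (~~ below 0 c)%:R.
pose h (c : 'I_4) : R := if below 2 c then z else 1.
have hE : \sum_c m c * h c = 1 - t2 * (1 - z).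
  by rewrite -(mass_below2 t0 t1 t2) -mass_pgf.
apply: (@le_trans _ _ (z ^- r * ((1 - t0) ^+ #|crossing S| * (1 - t2 * (1 - z)) ^+ #|inside S|))).
  rewrite -hE -mass_nbelow0 -(Ex_prod2 m_sum1 g h); last first.
    rewrite disjoint_subset; apply/subsetP => e; rewrite !inE => /andP[_ /negPf->//].
  rewrite -Ex_scale; apply: Pr_le_Ex => // x.
    rewrite mulr_ge0 ?invr_ge0 ?exprn_ge0 ?(ltW z0) // mulr_ge0 ?prodr_ge0 // => e _.
    by rewrite /h; case: ifP; rewrite ?(ltW z0).
  move=> /and3P[_ /eqP cut0 ins].
  have -> : \prod_(e in inside S) h (x e) = z ^+ #|lightc 2 x :&: inside S|.
    by rewrite -occ_lightc -prod_occ.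
  rewrite (prod_indic R (crossing S) (predC (below 0)) x) (introT forall_inP) /=; last first.
    move=> e eS; apply/negP => e0; have /setP/(_ e) := cut0.
    by rewrite in_setI [RHS]inE eS inE e0.
  rewrite mul1r ler_pdivlMl ?exprn_gt0 // mulr1.
  exact: ler_weXn2l.
rewrite mulrCA [X in _ <= X]mulrC ler_pM ?mulr_ge0 ?invr_ge0 ?exprn_ge0 ?(ltW z0) ?(le_trans ler01 h1) //.
- by case/andP: t0_01.
- by apply: ler_wiXn2l; [case/andP: t0_01..|rewrite card_crossing].
- rewrite ler_wpM2l ?invr_ge0 ?exprn_ge0 ?(ltW z0) //.
  by apply: ler_weXn2l; rewrite // card_inside.
Qed.

End Connected.
End Bounds.

(** * Asymptotics of the bounds *)

Section ExponentialBounds.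
Context {R : realType}.
Implicit Types (u v w : R).

Lemma exprD1_le_expR u m : 0 <= 1 + u -> (1 + u) ^+ m <= expR (u * m%:R).
Proof.
by move=> u1; rewrite expRM_natr; apply: lerXn2r; rewrite ?nnegrE ?expR_ge0 ?expR_ge1Dx.
Qed.

Lemma expR_le_D1 u : 0 <= u -> expR (u - u ^+ 2) <= 1 + u.
Proof.
move=> u0; have u1 : 0 < 1 + u by lra.
have h : u - u ^+ 2 <= u / (1 + u) by rewrite ler_pdivlMr //; nra.
apply: le_trans (_ : expR (u / (1 + u)) <= _); first by rewrite ler_expR.
rewrite -[X in _ <= X]invrK -[X in X <= _]invrK -expRN lef_pV2 ?posrE ?invr_gt0 ?expR_gt0 //.
apply: le_trans (expR_ge1Dx _); rewrite le_eqVlt; apply/orP; left; apply/eqP.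
by field; rewrite gt_eqF.
Qed.

(** This is 1 + w <= expR w at w = u / (1 - u), inverted. *)
Lemma expR_le_1B u : 0 <= u < 1 -> expR (- (u / (1 - u))) <= 1 - u.
Proof.
move=> /andP[u0 u1]; have v0 : 0 < 1 - u by lra.
rewrite expRN -[X in _ <= X]invrK lef_pV2 ?posrE ?invr_gt0 ?expR_gt0 //.
apply: le_trans (expR_ge1Dx _); rewrite le_eqVlt; apply/orP; left; apply/eqP.
by field; rewrite gt_eqF.
Qed.

Lemma two_le_expR1 : 2 <= expR (1 : R).
Proof. by have := expR_ge1Dx (1 : R); lra. Qed.

Lemma expR3_le64 : expR (3 : R) <= 64.
Proof.
have h : expR (2^-1 : R) <= 2.
  have := expR_ge1Dx (- 2^-1 : R); rewrite expRN => h.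
  have := expR_gt0 (2^-1 : R) => e0.
  have : expR (2^-1 : R) * (expR (2^-1 : R))^-1 = 1 by rewrite divff // gt_eqF.
  nra.
(* 3 = 6 / 2 and expR (1 / 2) <= 2. *)
have -> : (3 : R) = 2^-1 * 6%:R by field.
rewrite expRM_natr (_ : 64 = 2 ^+ 6 :> R); last by ring.
by apply: lerXn2r; rewrite ?nnegrE ?expR_ge0.
Qed.

Lemma pow2_le_expR k : 2 ^+ k <= expR (k%:R : R).
Proof.
rewrite -[X in expR X]mul1r expRM_natr.
by apply: lerXn2r; rewrite ?nnegrE ?expR_ge0 ?two_le_expR1.
Qed.

Lemma geometric_le u m : 0 <= u <= 2^-1 -> \sum_(i < m) u ^+ i.+1 <= 2 * u.
Proof.
move=> /andP[u0 u1].
(* The added term makes the bound inductive. *)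
suff : \sum_(i < m) u ^+ i.+1 + 2 * u ^+ m.+1 <= 2 * u.
  by apply: le_trans; rewrite lerDl mulr_ge0 ?exprn_ge0.
elim: m => [|m IH]; first by rewrite big_ord0 add0r expr1.
apply: le_trans IH; rewrite big_ord_recr /= -addrA lerD2l.
have := exprn_ge0 m.+1 u0; rewrite [u ^+ m.+2]exprS; nra.
Qed.

(** Both n ^ r >= r! * 'C(n, r) and r ^ r / r! <= expR r enter. *)
Lemma bin_le_expR n r : (0 < n)%N -> ('C(n, r))%:R * (r%:R / n%:R) ^+ r <= expR (r%:R : R).
Proof.
move=> n0; case: r => [|r]; first by rewrite expr0 mulr1 bin0 -[1%:R]addr0 expR_ge1Dx.
have h := @expR_ge1Dxn R r.+1%:R r (ler0n _ _).
apply: le_trans (_ : r.+1%:R ^+ r.+1 / (r.+1)`!%:R <= _); last first.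
  by apply: le_trans h; rewrite lerDr.
have f0 : 0 < (r.+1)`!%:R :> R by rewrite ltr0n fact_gt0.
rewrite expr_div_n mulrCA ler_pM2l ?exprn_gt0 ?ltr0n //.
rewrite ler_pdivrMr ?exprn_gt0 ?ltr0n // mulrC ler_pdivlMr //.
rewrite -natrM bin_ffact -natrX ler_nat.
have ffle a b : (a ^_ b <= a ^ b)%N.
  elim: b => [|b IH]; first by rewrite ffactn0.
  by rewrite ffactnSr expnSr leq_mul // leq_subr.
exact: ffle.
Qed.

End ExponentialBounds.

(** The parametrisation is l = ln (ln n) and y = sqrt (ln n), which makes all
    quantities explicit exponentials: ln n = y ^+ 2 = expR l.  The bound on l is
    large enough for every comparison of l, y and y ^+ 2 below. *)
Section Scale.
Context {R : realType}.
Variables (n : nat) (y l : R).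
Hypothesis l_ge : 200 <= l.
Hypothesis yE : y = expR (l / 2).
Hypothesis nE : n%:R = expR (y ^+ 2).

Lemma scale_y_ge : 20 * l <= y.
Proof.
rewrite yE; have l0 : 0 <= l / 2 by move: l_ge; lra.
have := expR_ge1Dxn 1 l0; rewrite (_ : 2`!%:R = 2 :> R) //.
move: l_ge; nra.
Qed.

Lemma scale_expR : expR l = y ^+ 2.
Proof. by rewrite yE -expRM_natr; congr expR; field. Qed.

Lemma scale_n_ge : 4 * y ^+ 2 * y ^+ 2 <= n%:R.
Proof.
have := expR_ge1Dxn 2 (sqr_ge0 y); rewrite -nE (_ : 3`!%:R = 6 :> R) // => h.
apply: le_trans h; have := scale_y_ge; set Y := y ^+ 2 => h.
have Y1 : 24 <= Y by rewrite /Y; move: l_ge; nra.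
have : 4 * Y * Y <= Y ^+ 3 / 6 by rewrite ler_pdivlMr //; nra.
lra.
Qed.

Let Y : R := y ^+ 2.
Let m : R := n%:R.

Lemma scale_facts : [/\ 200 <= y, l * y <= Y / 20, 200 * y <= l * y,
  200 * y <= Y & 4 * Y * Y <= m].
Proof.
have := scale_y_ge; have := scale_n_ge; rewrite -/Y -/m /Y => h1 h2.
by split => //; move: l_ge; nra.
Qed.

Lemma scale_n_gt0 : 0 < m.
Proof. by case: scale_facts => h1 h2 h3 h4 h5; nra. Qed.

Lemma scale_predn : n.-1%:R = m - 1.
Proof.
have : (0 < n)%N by rewrite -(ltr0n R) scale_n_gt0.
by move=> n0; rewrite /m -[in RHS](prednK n0) -natr1 addrK.
Qed.

Lemma scale_n_gt1 : (1 < n)%N.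
Proof. by rewrite -(ltr1n R) -/m; case: scale_facts => h1 h2 h3 h4 h5; nra. Qed.

(** The parameter of the exponential bounds at level s/n: it is half the ratio of
    the gap l * y / 4 between s and k to ln n, which nearly optimises them. *)
Lemma tilt_facts (r := l / (8 * y)) : [/\ 0 <= r, r <= 1 & r * y = l / 8].
Proof.
case: scale_facts => h1 h2 h3 h4 h5; have hy := scale_y_ge; have hl := l_ge.
have y0 : 0 < 8 * y by lra.
split; first by rewrite /r divr_ge0; lra.
- by rewrite /r ler_pdivrMr //; lra.
- by rewrite /r; field; lra.
Qed.

(** Levels for the first half: Y - s = l * y / 4, and k is below s by as much. *)
Section Lower.
Let s : R := Y - l * y / 4.
Let p : R := s / m.
Let q : R := 16 * Y / m.

Lemma lower_level_facts : [/\ 1 <= s, s <= Y, s * s <= m, s * Y + s <= m & 2 * s <= m].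
Proof. by rewrite /s; case: scale_facts => h1 h2 h3 h4 h5; split; nra. Qed.

Lemma lower_thresholds : [/\ 0 <= p, p <= q, q <= 1, p <= 2^-1 & p < 1].
Proof.
have m0 := scale_n_gt0.
case: scale_facts lower_level_facts => h1 h2 h3 h4 h5 [a1 a2 a3 a4 a5].
have ph : p <= 2^-1 by rewrite /p ler_pdivrMr //; lra.
split => //; last by lra.
- by rewrite /p divr_ge0; lra.
- by rewrite /p /q ler_pM2r ?invr_gt0 //; lra.
- by rewrite /q ler_pdivrMr // mul1r; nra.
Qed.

(** Since s is l * y / 4 below ln n, the mean is at least expR (l * y / 4 - 1). *)
Lemma expected_isolated_large : expR l <= m * (1 - p) ^+ n.-1.
Proof.
have m0 := scale_n_gt0; case: lower_thresholds => p0 pq q1 ph p1.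
case: scale_facts lower_level_facts => h1 h2 h3 h4 h5 [a1 a2 a3 a4 a5].
have P1 : expR (- (p / (1 - p)) * n.-1%:R) <= (1 - p) ^+ n.-1.
  rewrite expRM_natr; apply: lerXn2r; rewrite ?nnegrE ?expR_ge0 ?subr_ge0 ?(ltW p1) //.
  by apply: expR_le_1B; rewrite p0 p1.
apply: le_trans (ler_wpM2l (ltW m0) P1).
rewrite {1}/m nE -expRD ler_expR scale_predn.
have -> : p / (1 - p) = s / (m - s) by rewrite /p; field; apply/andP; split; lra.
have : s / (m - s) * (m - 1) <= s + 1.
  by rewrite mulrAC ler_pdivrMr; [nra|lra].
rewrite mulNr -/Y; move: (_ / _ * _) => w; rewrite /s; have := l_ge; have := scale_y_ge; lra.
Qed.

Lemma low_variance_term : p / (1 - p) <= expR (- l).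
Proof.
have m0 := scale_n_gt0; case: lower_thresholds => p0 pq q1 ph p1.
case: scale_facts lower_level_facts => h1 h2 h3 h4 h5 [a1 a2 a3 a4 a5].
rewrite expRN scale_expR -/Y.
have -> : p / (1 - p) = s / (m - s) by rewrite /p; field; apply/andP; split; lra.
have Y0 : 0 < Y by lra.
rewrite ler_pdivrMr; last by lra.
by rewrite ler_pdivlMl //; lra.
Qed.

Variable k : nat.
Hypothesis k_le : k%:R <= Y - l * y / 2.

Lemma few_term : 2 ^+ k * (1 - (q - p) / 2) ^+ n.-1 <= expR (- l).
Proof.
have m0 := scale_n_gt0; case: lower_thresholds => p0 pq q1 ph p1.
case: scale_facts lower_level_facts => h1 h2 h3 h4 h5 [a1 a2 a3 a4 a5].
have P1 : (1 + - ((q - p) / 2)) ^+ n.-1 <= expR (- ((q - p) / 2) * n.-1%:R).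
  by apply: exprD1_le_expR; lra.
apply: le_trans (_ : expR k%:R * expR (- ((q - p) / 2) * n.-1%:R) <= _).
  by apply: ler_pM; rewrite ?exprn_ge0 ?pow2_le_expR //; lra.
rewrite -expRD ler_expR scale_predn.
have : (15 / 2) * Y <= (q - p) * (m - 1).
  have -> : (q - p) * (m - 1) = (16 * Y - s) * (m - 1) / m.
    by rewrite /q /p; field; rewrite gt_eqF.
  have : 0 <= (Y - s) * (m - 1) by rewrite mulr_ge0; lra.
  have : 0 <= Y * (m - 2) by rewrite mulr_ge0; lra.
  by rewrite ler_pdivlMr //; lra.
have -> : - ((q - p) / 2) * (m - 1) = - ((q - p) * (m - 1) / 2) by field.
by move: (_ * (m - 1)) => w; have := scale_y_ge; have := l_ge; have := k_le; lra.
Qed.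

(** The number of candidate edges is at most 32 * ln n on average, and the lower
    tail of the degree contributes expR (- l ^+ 2 / 64), up to a constant. *)
Lemma spoilt_term (r := l / (8 * y)) (z := (1 + r)^-1) :
  n.-1%:R * ((q - p) / (1 - p)) * (z ^- k * (1 - p * (1 - z)) ^+ n.-1.-1) <=
  expR (- l).
Proof.
have m0 := scale_n_gt0; case: lower_thresholds => p0 pq q1 ph p1.
case: scale_facts lower_level_facts => h1 h2 h3 h4 h5 [a1 a2 a3 a4 a5].
case: tilt_facts; rewrite -/r => r0 r1 ry.
have hl := l_ge; have hy := scale_y_ge.
have Y_ge0 : 0 <= Y := sqr_ge0 y.
have m1_ge0 : 0 <= m - 1 by lra.
have u0 : 0 < 1 + r by lra.
have zE : 1 - z = r / (1 + r) by rewrite /z; field; rewrite gt_eqF.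
have z1 : r - r ^+ 2 <= 1 - z by rewrite zE ler_pdivlMr //; nra.
have z0 : 0 <= 1 - z <= 1.
  by rewrite zE divr_ge0 ?(ltW u0) //= ler_pdivrMr //; lra.
have P1 : z ^- k <= expR (r * k%:R).
  by rewrite /z exprVn invrK; apply: exprD1_le_expR; lra.
have pz0 : 0 <= p * (1 - z) by rewrite mulr_ge0 //; case/andP: z0.
have pz1 : p * (1 - z) <= p by rewrite ler_piMr //; case/andP: z0.
have w0 : 0 <= 1 - p * (1 - z) by rewrite subr_ge0 (le_trans pz1) // ltW.
have P2 : (1 + - (p * (1 - z))) ^+ n.-1.-1 <= expR (- (p * (1 - z)) * n.-1.-1%:R).
  by apply: exprD1_le_expR.
have P3 : n.-1%:R * ((q - p) / (1 - p)) <= 32 * Y.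
  rewrite scale_predn mulrA ler_pdivrMr; last by lra.
  have : (m - 1) * (q - p) <= 16 * Y.
    have qm : m * q = 16 * Y by rewrite /q mulrC divfK // gt_eqF.
    have : 0 <= (m - 1) * p by rewrite mulr_ge0.
    lra.
  have : 0 <= Y * (2^-1 - p) by rewrite mulr_ge0 ?subr_ge0.
  lra.
have NE : n.-1.-1%:R = m - 2.
  have n1 : (0 < n.-1)%N by rewrite -subn1 subn_gt0 scale_n_gt1.
  by move: scale_predn; rewrite -{1}(prednK n1) -natr1 => h; lra.
have P4 : expR (r * k%:R) * expR (- (p * (1 - z)) * n.-1.-1%:R) <= expR (1 - l ^+ 2 / 64).
  rewrite -expRD ler_expR NE.
  have pm : s - 1 <= p * (m - 2).
    have -> : p * (m - 2) = s - 2 * p by rewrite /p; field; rewrite gt_eqF.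
    lra.
  have r2 : 0 <= r - r ^+ 2 by nra.
  have e1 : (s - 1) * (r - r ^+ 2) <= p * (m - 2) * (1 - z).
    apply: ler_pM => //; lra.
  have e2 : r * k%:R <= r * (Y - l * y / 2) by rewrite ler_wpM2l.
  have e3 : r * (l * y) = l ^+ 2 / 8.
    by rewrite mulrCA ry; field.
  have e4 : r ^+ 2 * Y = l ^+ 2 / 64 by rewrite -exprMn ry; field.
  have e5 : (s - 1) * r ^+ 2 <= Y * r ^+ 2 by rewrite ler_wpM2r ?sqr_ge0 //; lra.
  have e6 : (s - 1) * (r - r ^+ 2) = r * Y - r * (l * y) / 4 - r - (s - 1) * r ^+ 2.
    by rewrite /s; field.
  lra.
apply: le_trans (_ : 32 * Y * expR (1 - l ^+ 2 / 64) <= _).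
  apply: ler_pM => //.
  - by rewrite mulr_ge0 // divr_ge0 // subr_ge0 // ltW.
  - by rewrite mulr_ge0 ?invr_ge0 ?exprn_ge0 ?invr_ge0 ?(ltW u0).
  apply: le_trans P4; apply: ler_pM => //.
  - by rewrite invr_ge0 exprn_ge0 // invr_ge0 ltW.
  - by rewrite exprn_ge0.
have h32 : 32 <= expR (5 : R).
  by have := pow2_le_expR (R := R) 5; apply: le_trans; rewrite -natrX ler_nat.
apply: le_trans (_ : expR 5 * expR l * expR (1 - l ^+ 2 / 64) <= _).
  by rewrite ler_wpM2r ?expR_ge0 // scale_expR -/Y ler_wpM2r.
by rewrite -!expRD ler_expR; nra.
Qed.

End Lower.

(** Levels for the second half: s - Y = l * y / 4, and K is above s by as much.
    The bound b on the number of saturated edges is about n / sqrt (ln n). *)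
Section Upper.
Variables (K b : nat).
Hypothesis K_ge : Y + l * y / 2 <= K%:R.
Hypothesis K_le : K%:R <= Y + l * y / 2 + 1.
Hypothesis b_le : b%:R <= m / y.
Hypothesis b_ge : m <= 2 * y * b%:R.

Let s : R := Y + l * y / 4.
Let e : R := expR 3.
Let p0 : R := Y / (e * m).
Let p : R := s / m.
Let q : R := 16 * Y / m.

Lemma expR_expn u j : (expR u) ^- j = expR (- (u * j%:R)) :> R.
Proof. by rewrite expRN expRM_natr. Qed.

Lemma upper_level_facts : [/\ 1 <= e, e <= 64, Y <= s, s <= 2 * Y & 2 * s <= m].
Proof.
rewrite /s /e; case: scale_facts => h1 h2 h3 h4 h5; split.
- by rewrite -expR0 ler_expR.
- exact: expR3_le64.
- by lra.
- by lra.
- by nra.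
Qed.

Lemma upper_thresholds :
  [/\ 0 <= p0, p0 <= p, p <= q & q <= 1] /\ [/\ p <= 1, p * m = s & e * p0 * m = Y].
Proof.
have m0 := scale_n_gt0; case: upper_level_facts => e1 e2 s1 s2 s3.
case: scale_facts => h1 h2 h3 h4 h5.
have q1 : q <= 1 by rewrite /q ler_pdivrMr // mul1r; nra.
have pq : p <= q by rewrite /p /q ler_pM2r ?invr_gt0 //; lra.
have em : 0 < e * m by rewrite mulr_gt0 //; lra.
split; split => //.
- by rewrite /p0 divr_ge0; lra.
- rewrite /p0 ler_pdivrMr // /p mulrCA divfK ?gt_eqF //.
  by have : 0 <= (e - 1) * s; [rewrite mulr_ge0; lra | lra].
- by apply: le_trans pq q1.
- by rewrite /p divfK // gt_eqF.
- by rewrite /p0; field; rewrite !gt_eqF //; lra.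
Qed.

Lemma light_degree_term :
  m * (e ^- K.+1 * (1 - p0 * (1 - e)) ^+ n.-1) <= expR (- l).
Proof.
have m0 := scale_n_gt0; case: upper_level_facts => e1 e2 s1 s2 s3.
case: scale_facts => h1 h2 h3 h4 h5; case: upper_thresholds => -[a1 a2 a3 a4] [a5 a6 a7].
have P : (1 + - (p0 * (1 - e))) ^+ n.-1 <= expR (- (p0 * (1 - e)) * n.-1%:R).
  apply: exprD1_le_expR; have : 0 <= p0 * (e - 1) by rewrite mulr_ge0; lra.
  lra.
rewrite mulrA; apply: le_trans (ler_wpM2l _ P) _.
  by rewrite mulr_ge0 ?(ltW m0) // invr_ge0 exprn_ge0; lra.
rewrite {1}/m nE expR_expn -!expRD ler_expR scale_predn -/Y.
have : - (p0 * (1 - e)) * (m - 1) <= Y.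
  have : 0 <= p0 * m by rewrite mulr_ge0; lra.
  have : 0 <= p0 * (e - 1) by rewrite mulr_ge0; lra.
  lra.
rewrite -natr1; move: (_ * (m - 1)) K_ge l_ge scale_y_ge => w; lra.
Qed.

Lemma heavy_degree_term :
  m * (2^-1 ^- K * (1 - q * (1 - 2^-1)) ^+ n.-1) <= expR (- l).
Proof.
have m0 := scale_n_gt0; case: upper_level_facts => e1 e2 s1 s2 s3.
case: scale_facts => h1 h2 h3 h4 h5; case: upper_thresholds => -[a1 a2 a3 a4] [a5 a6 a7].
have P : (1 + - (q * (1 - 2^-1))) ^+ n.-1 <= expR (- (q * (1 - 2^-1)) * n.-1%:R).
  by apply: exprD1_le_expR; lra.
rewrite exprVn invrK mulrA.
apply: le_trans (_ : m * expR K%:R * expR (- (q * (1 - 2^-1)) * n.-1%:R) <= _).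
  apply: ler_pM => //.
  - by rewrite mulr_ge0 ?exprn_ge0 ?(ltW m0).
  - by rewrite exprn_ge0 //; lra.
  - by rewrite ler_wpM2l ?pow2_le_expR ?(ltW m0).
rewrite {1}/m nE -!expRD ler_expR scale_predn -/Y.
have qm : q * m = 16 * Y by rewrite /q divfK // gt_eqF.
have : q * (1 - 2^-1) * (m - 1) >= 7 * Y by lra.
rewrite mulNr; move: (_ * (m - 1)) K_le l_ge scale_y_ge => w; lra.
Qed.

(** The upper tail of the degree is at most expR (- l ^+ 2 / 128), which is smaller
    than the fraction b / n of the vertices that may be crowded. *)
Lemma crowded_term (r := l / (8 * y)) (z := 1 + r) :
  m / b%:R * (z ^- K * (1 - p * (1 - z)) ^+ n.-1) <= expR (- l).
Proof.
have m0 := scale_n_gt0; case: upper_level_facts => e1 e2 s1 s2 s3.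
case: scale_facts => h1 h2 h3 h4 h5; case: upper_thresholds => -[a1 a2 a3 a4] [a5 a6 a7].
case: tilt_facts; rewrite -/r => r0 r1 ry.
have hl := l_ge; have hy := scale_y_ge; have kge := K_ge; have kle := K_le.
have z0 : 0 < z by rewrite /z; lra.
have y0 : 0 < y by lra.
have b0 : 0 < b%:R :> R.
  by have := lt_le_trans m0 b_ge; rewrite pmulr_rgt0 // mulr_gt0.
have mb : m / b%:R <= 2 * y by rewrite ler_pdivrMr // b_ge.
have P1 : z ^- K <= expR (- ((r - r ^+ 2) * K%:R)).
  rewrite -expR_expn lef_pV2 ?posrE ?exprn_gt0 ?expR_gt0 //.
  by apply: lerXn2r; rewrite ?nnegrE ?expR_ge0 ?(ltW z0) // expR_le_D1.
have l0 : 0 <= l by lra.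
have p_ge0 : 0 <= p := le_trans a1 a2.
have pr : 0 <= p * r by rewrite mulr_ge0.
have zr : - (p * (1 - z)) = p * r by rewrite /z; ring.
have w0 : 0 <= 1 - p * (1 - z) by rewrite zr addr_ge0.
have P2 : (1 - p * (1 - z)) ^+ n.-1 <= expR (p * r * n.-1%:R).
  by rewrite zr; apply: exprD1_le_expR; rewrite addr_ge0.
have P3 : z ^- K * (1 - p * (1 - z)) ^+ n.-1 <= expR (- (l ^+ 2 / 128)).
  apply: le_trans (_ : expR (- ((r - r ^+ 2) * K%:R)) * expR (p * r * n.-1%:R) <= _).
    apply: ler_pM => //; first by rewrite invr_ge0 exprn_ge0 // ltW.
    by rewrite exprn_ge0.
  rewrite -expRD ler_expR scale_predn.
  have c1 : p * r * (m - 1) <= r * s.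
    have -> : p * r * (m - 1) = r * (p * m) - p * r by ring.
    by rewrite a6; lra.
  have c2 : r * (Y + l * y / 2) <= r * K%:R by rewrite ler_wpM2l.
  have c3 : r ^+ 2 * K%:R <= r ^+ 2 * (3 / 2 * Y) by rewrite ler_wpM2l ?sqr_ge0 //; lra.
  have c4 : r * (l * y) = l ^+ 2 / 8 by rewrite mulrCA ry; field.
  have c5 : r ^+ 2 * Y = l ^+ 2 / 64 by rewrite -exprMn ry; field.
  have c6 : r * s = r * Y + r * (l * y) / 4 by rewrite /s; field.
  lra.
apply: le_trans (_ : 2 * y * expR (- (l ^+ 2 / 128)) <= _).
  apply: ler_pM => //.
  - by rewrite divr_ge0 // ltW.
  - by rewrite mulr_ge0 ?invr_ge0 ?exprn_ge0 ?(ltW z0).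
apply: le_trans (_ : expR 1 * expR (l / 2) * expR (- (l ^+ 2 / 128)) <= _).
  by rewrite ler_wpM2r ?expR_ge0 // -yE ler_wpM2r ?(ltW y0) // two_le_expR1.
rewrite -!expRD ler_expR.
have : 0 <= (l - 200) * l by rewrite mulr_ge0 ?subr_ge0.
by rewrite expr2; lra.
Qed.

(** Of the at least n - 1 - b unsaturated edges at v, at least s - 2 * y - 1 are
    expected in G_p, where s = ln n + l * y / 4; here l * y / 4 outweighs 2 * y. *)
Lemma starved_term (z := expR (- l)) :
  m * (z^-1 * (1 - p * (1 - z)) ^+ (n.-1 - b)) <= expR (- l).
Proof.
have m0 := scale_n_gt0; case: upper_level_facts => e1 e2 s1 s2 s3.
case: scale_facts => h1 h2 h3 h4 h5; case: upper_thresholds => -[a1 a2 a3 a4] [a5 a6 a7].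
have hl := l_ge; have hy := scale_y_ge.
have y0 : 0 < y by lra.
have Y0 : 0 < Y by lra.
have zY : z * Y = 1 by rewrite /z expRN scale_expR mulVf // gt_eqF.
have z01 : 0 <= z <= 1.
  by rewrite /z expR_ge0 -expR0 ler_expR; lra.
have zz : 0 <= 1 - z <= 1 by lra.
have p_ge0 : 0 <= p := le_trans a1 a2.
have pz0 : 0 <= p * (1 - z) by rewrite mulr_ge0 //; case/andP: zz.
have pz1 : p * (1 - z) <= p by rewrite ler_piMr //; case/andP: zz.
have P : (1 + - (p * (1 - z))) ^+ (n.-1 - b) <= expR (- (p * (1 - z)) * (n.-1 - b)%:R).
  by apply: exprD1_le_expR; lra.
have zV : z^-1 = expR l by rewrite /z expRN invrK.
rewrite mulrA zV; apply: le_trans (ler_wpM2l _ P) _.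
  by rewrite mulr_ge0 ?expR_ge0 ?(ltW m0).
rewrite {1}/m nE -!expRD ler_expR -/Y.
have Nb : m - 1 - m / y <= (n.-1 - b)%:R.
  have : n.-1%:R <= (n.-1 - b)%:R + b%:R :> R by rewrite -natrD ler_nat addnC -leq_subLR.
  by rewrite scale_predn; have := b_le; lra.
have c1 : s - 2 * y - 1 <= p * (m - 1 - m / y).
  have -> : p * (m - 1 - m / y) = s - p - s / y.
    by rewrite -a6; field; rewrite gt_eqF.
  have : s / y <= 2 * y by rewrite ler_pdivrMr // -mulrA -expr2 -/Y.
  lra.
have c2 : p * (m - 1 - m / y) * z <= 2.
  apply: le_trans (_ : 2 * Y * z <= _); last by rewrite -mulrA [Y * z]mulrC zY; lra.
  have my : 0 <= m / y by rewrite divr_ge0 // ltW.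
  have : 0 <= p * (1 + m / y) by rewrite mulr_ge0 ?addr_ge0 // (le_trans a1).
  by move=> ?; apply: ler_wpM2r; lra.
have c3 : p * (1 - z) * (m - 1 - m / y) <= p * (1 - z) * (n.-1 - b)%:R by rewrite ler_wpM2l.
have c4 : p * (1 - z) * (m - 1 - m / y) = p * (m - 1 - m / y) - p * (m - 1 - m / y) * z by ring.
rewrite mulNr; move: (p * (1 - z) * (n.-1 - b)%:R) c3 => w c3.
rewrite /s in c1; lra.
Qed.

(** Only b * p <= 2 * y of the saturated edges are expected in G_p, while nearly
    K >= y ^+ 2 of them would be required. *)
Lemma choked_term :
  m * (e ^- K.-1 * (1 - p * (1 - e)) ^+ b) <= expR (- l).
Proof.
have m0 := scale_n_gt0; case: upper_level_facts => e1 e2 s1 s2 s3.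
case: scale_facts => h1 h2 h3 h4 h5; case: upper_thresholds => -[a1 a2 a3 a4] [a5 a6 a7].
have hl := l_ge; have hy := scale_y_ge; have kge := K_ge.
have y0 : 0 < y by lra.
have K0 : (0 < K)%N by rewrite -(ltr0n R); lra.
have KE : K.-1%:R = K%:R - 1 :> R by rewrite -[in RHS](prednK K0) -natr1 addrK.
have pe : 0 <= p * (e - 1) by rewrite mulr_ge0 ?subr_ge0 // (le_trans a1).
have P : (1 + - (p * (1 - e))) ^+ b <= expR (- (p * (1 - e)) * b%:R).
  by apply: exprD1_le_expR; lra.
rewrite mulrA; apply: le_trans (ler_wpM2l _ P) _.
  by rewrite mulr_ge0 ?(ltW m0) // invr_ge0 exprn_ge0 // (le_trans ler01).
rewrite {1}/m nE expR_expn -!expRD ler_expR KE -/Y.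
have pb : p * b%:R <= 2 * y.
  apply: le_trans (_ : p * (m / y) <= _); first by rewrite ler_wpM2l ?b_le //; lra.
  by rewrite mulrA a6 ler_pdivrMr // -mulrA -expr2 -/Y.
have c : - (p * (1 - e)) * b%:R <= 126 * y.
  have -> : - (p * (1 - e)) * b%:R = (e - 1) * (p * b%:R) by ring.
  apply: le_trans (_ : (e - 1) * (2 * y) <= _); first by rewrite ler_wpM2l //; lra.
  by have : 0 <= (64 - e) * y; [rewrite mulr_ge0 ?subr_ge0 // ltW | lra].
move: (_ * b%:R) c => w; lra.
Qed.

Lemma sum_by_card (F : nat -> R) : (forall r, 0 <= F r) ->
  \sum_(S : {set 'I_n} | (0 < #|S|)%N && (#|S|.*2 <= n)%N) F #|S| <=
  \sum_(r < n) 'C(n, r.+1)%:R * (if (r.+1.*2 <= n)%N then F r.+1 else 0).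
Proof.
move=> F0; pose h (S : {set 'I_n}) : 'I_n.+1 := inord #|S|.
have hE S : h S = #|S| :> nat by rewrite inordK // ltnS -[X in (_ <= X)%N]card_ord max_card.
rewrite (partition_big h predT) //= big_ord_recl /= big1 ?add0r; last first.
  by move=> S /andP[/andP[S0 _] /eqP h0]; move: S0; rewrite -hE h0.
apply: ler_sum => r _; case: ifPn => r2; last first.
  rewrite mulr0 big1 // => S /andP[/andP[_ S2] /eqP hr].
  by move: r2; rewrite -[r.+1]/(lift ord0 r : nat) -hr hE S2.
apply: le_trans (_ : \sum_(S in [set S : {set 'I_n} | #|S| == r.+1]%SET) F r.+1 <= _).
  rewrite big_mkcond [X in _ <= X]big_mkcond; apply: ler_sum => S _ /=.
  rewrite finset.in_set; case: ifP => [/andP[_ /eqP hr]|_].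
    by rewrite -hE hr eqxx.
  by case: ifP.
by rewrite sumr_const card_draws card_ord mulr_natl.
Qed.

(** Sets of r vertices contribute at most th ^+ r with th = expR (l + 17 - Y / 128):
    the inner edges give (r / n) ^+ r * (ln n) ^+ r * expR (16 * r), the crossing
    ones expR (- r * Y / 128), and the first factor is compensated by the number
    of sets, see [bin_le_expR]. *)
Lemma sparse_cut_term (z := fun r : nat => 1 + m / (r%:R * Y)) :
  \sum_(S : {set 'I_n} | (0 < #|S|)%N && (#|S|.*2 <= n)%N)
     z #|S| ^- #|S| * (1 - q * (1 - z #|S|)) ^+ (#|S| * #|S|) *
     (1 - p0) ^+ (#|S| * (n - #|S|)) <= 2 * expR (- l).
Proof.
have m0 := scale_n_gt0; case: upper_level_facts => e1 e2 s1 s2 s3.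
case: scale_facts => h1 h2 h3 h4 h5; case: upper_thresholds => -[a1 a2 a3 a4] [a5 a6 a7].
have hl := l_ge; have hy := scale_y_ge.
have Y0 : 0 < Y by lra.
have p01 : 0 <= 1 - p0 <= 1 by lra.
have z1 r : 1 <= z r.
  rewrite /z lerDl; apply: divr_ge0; first exact: ltW.
  by apply: mulr_ge0; [exact: ler0n | exact: ltW].
have zp r : 0 < z r := lt_le_trans ltr01 (z1 r).
have qz r : 0 <= q * (z r - 1) by rewrite mulr_ge0 ?subr_ge0 ?z1 // (le_trans a1 (le_trans a2 a3)).
have w0 r : 0 <= 1 - q * (1 - z r).
  by have := qz r; rewrite -[z r - 1]opprB mulrN => h; rewrite addr_ge0.
pose th : R := expR (l + 17 - Y / 128).
pose F r := z r ^- r * (1 - q * (1 - z r)) ^+ (r * r) * (1 - p0) ^+ (r * (n - r)).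
apply: le_trans (sum_by_card (F := F) _) _.
  move=> r; rewrite /F !mulr_ge0 ?invr_ge0 ?exprn_ge0 //.
  - exact: ltW.
  - by case/andP: p01.
have th_le : th <= expR (- l) / 2.
  rewrite ler_pdivlMr // mulrC; apply: le_trans (_ : expR 1 * th <= _).
    by rewrite ler_wpM2r ?expR_ge0 ?two_le_expR1.
  by rewrite /th -expRD ler_expR; lra.
have el1 : expR (- l) <= 1 by rewrite -expR0 ler_expR; lra.
have th0 : 0 <= th by exact: expR_ge0.
apply: le_trans (_ : \sum_(r < n) th ^+ r.+1 <= _); last first.
  by apply: le_trans (geometric_le n _) _; lra.
apply: ler_sum => i _; case: ifPn => r2; last by rewrite mulr0 exprn_ge0.
move: r2; set r := i.+1 => r2.
have r0 : 0 < r%:R :> R by rewrite ltr0n.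
have rY : 0 < r%:R * Y by rewrite mulr_gt0.
have rn : (r <= n)%N by apply: leq_trans r2; rewrite -addnn leq_addr.
have mr : m / 2 <= (n - r)%:R.
  rewrite natrB // -/m; have : (r.*2)%:R <= m by rewrite /m ler_nat.
  by rewrite -muln2 natrM; lra.
have T1 : z r ^- r <= (r%:R / m) ^+ r * expR (l * r%:R).
  rewrite expRM_natr scale_expR -/Y -exprMn -exprVn; apply: lerXn2r.
  - by rewrite nnegrE invr_ge0 ltW.
  - by rewrite nnegrE mulr_ge0 ?divr_ge0 ?(ltW m0) ?(ltW r0) ?(ltW Y0).
  have -> : r%:R / m * Y = (m / (r%:R * Y))^-1 by field; rewrite !gt_eqF.
  by rewrite lef_pV2 ?posrE ?divr_gt0 // /z lerDr.
have T2 : (1 - q * (1 - z r)) ^+ (r * r) <= expR (16 * r%:R).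
  have qzr : - (q * (1 - z r)) = 16 / r%:R by rewrite /q /z; field; rewrite !gt_eqF.
  rewrite qzr; apply: le_trans (exprD1_le_expR _ _) _; first by rewrite addr_ge0 ?divr_ge0.
  by rewrite ler_expR natrM mulrA divfK ?gt_eqF.
have T3 : (1 - p0) ^+ (r * (n - r)) <= expR (- (Y / 128) * r%:R).
  apply: le_trans (exprD1_le_expR _ _) _; first by case/andP: p01.
  rewrite ler_expR natrM !mulNr lerN2.
  rewrite [X in _ <= X]mulrCA [X in _ <= X]mulrC; apply: ler_wpM2r; first exact: ltW.
  have : p0 * (m / 2) <= p0 * (n - r)%:R by rewrite ler_wpM2l.
  have c64 : 0 <= (64 - e) * (p0 * m).
    by apply: mulr_ge0; [rewrite subr_ge0 | apply: mulr_ge0; last exact: ltW].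
  have c65 : Y / 64 <= p0 * m by lra.
  by move: (p0 * (n - r)%:R) => w; lra.
apply: le_trans (_ : 'C(n, r)%:R * ((r%:R / m) ^+ r * expR (l * r%:R) * expR (16 * r%:R) *
    expR (- (Y / 128) * r%:R)) <= _).
  rewrite ler_wpM2l // /F; have u0 : 0 <= z r ^- r by rewrite invr_ge0 exprn_ge0 // ltW.
  have v0 : 0 <= (1 - q * (1 - z r)) ^+ (r * r) by rewrite exprn_ge0.
  apply: ler_pM T3; [by rewrite mulr_ge0 | by rewrite exprn_ge0 //; case/andP: p01 | exact: ler_pM].
have nn : (0 < n)%N by rewrite -(ltr0n R).
have := bin_le_expR (R := R) r nn; rewrite -/m => B.
have -> : (r%:R / m) ^+ r * expR (l * r%:R) * expR (16 * r%:R) *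
    expR (- (Y / 128) * r%:R) = (r%:R / m) ^+ r * expR ((l + 16 - Y / 128) * r%:R).
  by rewrite -!mulrA -!expRD; congr (_ * expR _); ring.
rewrite mulrA; apply: le_trans (ler_wpM2r _ B) _; first exact: expR_ge0.
rewrite -expRD /th -expRM_natr ler_expR le_eqVlt; apply/orP; left; apply/eqP; ring.
Qed.

End Upper.
End Scale.

(** * The two halves of the theorem *)

Section Order.
Context {R : realType} {n : nat}.
Implicit Types (x : edge n -> R) (k : nat).

Lemma LK_order x x' k : (forall e f, (x e < x f) = (x' e < x' f)) ->
  LK x k =2 LK x' k.
Proof.
move=> xx' i j; have E v e : among_lowest x k v e = among_lowest x' k v e.
  by congr (_ && (_ < _)%N); apply: eq_card => f; rewrite !inE xx'.
by apply: eq_existsb => e; rewrite !E.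
Qed.

Lemma graph_connected_sub (g h : rel 'I_n) : subrel g h ->
  graph_connected g -> graph_connected h.
Proof.
by move=> gh cg i j; apply: connect_sub (cg i j) => u v /gh; exact: connect1.
Qed.

Lemma LK_mono x k k' : (k <= k')%N -> subrel (LK x k) (LK x k').
Proof.
move=> kk' i j /LK_edge[e ee /LKedgesP eL]; apply/LK_edge; exists e => //.
by apply/LKedgesP => v /eL h; apply: leq_trans h kk'.
Qed.

End Order.

Section FixedSize.
Local Open Scope classical_set_scope.
Local Open Scope ring_scope.
Context {R : realType} {n : nat} {d : measure_display} {T : measurableType d}.
Variables (P : probability T R) (W : edge n -> {RV P >-> R}).
Hypothesis iidW : iid_uniform01 W.
Implicit Types (k : nat).

Local Notation wt w := (fun e => W e w).

Lemma measurable_connected k : measurable [set w | graph_connected (LK (wt w) k)].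
Proof.
apply: (measurable_order_event (X := W)) => w w' ww'.
apply: graph_connected_sub => i j; rewrite (LK_order (x' := wt w')) //.
Qed.

Lemma prob_ge_of_finite (t0 t1 t2 : R) (Q : pred {ffun edge n -> 'I_4}) (A : set T) b :
  0 <= t0 -> t0 <= t1 -> t1 <= t2 -> t2 <= 1 -> measurable A ->
  (forall w, ~~ Q (wclasses t0 t1 t2 W w) -> A w) ->
  Pr (pclass t0 t1 t2) Q <= b -> ((1 - b)%:E <= P A)%E.
Proof.
move=> h0 h01 h12 h2 mA QA Qb.
apply: (@le_trans _ _ (P [set w | (predC Q) (wclasses t0 t1 t2 W w)])).
  by rewrite prob_wclasses // lee_fin (Pr_predC (pclass_sum1 _ _ _)) lerB.
apply: le_measure; rewrite ?inE //.
apply: (measurable_finite_range (D := wclasses t0 t1 t2 W)) => [c|w w' /= -> //].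
by apply: measurable_ffun_fiber => i j; exact: measurable_wclass_RV.
Qed.

Variables (y l : R).
Hypothesis l_ge : 200 <= l.
Hypothesis yE : y = expR (l / 2).
Hypothesis nE : n%:R = expR (y ^+ 2).

Lemma light_wclasses (t0 t1 t2 : R) w : t0 <= t1 -> t1 <= t2 ->
  [/\ light (wt w) t0 = lightc 0 (wclasses t0 t1 t2 W w),
      light (wt w) t1 = lightc 1 (wclasses t0 t1 t2 W w) &
      light (wt w) t2 = lightc 2 (wclasses t0 t1 t2 W w)].
Proof.
move=> h01 h12; split; apply/setP => e; rewrite !finset.in_set ffunE.
- by rewrite below0E.
- by rewrite below1E.
- by rewrite below2E.
Qed.

Lemma disconnected_prob k : k%:R <= y ^+ 2 - l * y / 2 ->
  ((1 - 12 * expR (- l))%:E <= P [set w | ~ graph_connected (LK (wt w) k)])%E.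
Proof.
move=> k_le.
have [p0 pq q1 ph p1] := lower_thresholds l_ge yE nE.
have n1 := scale_n_gt1 l_ge yE nE.
set p := (_ - _) / _ in p0 pq ph p1; set q := 16 * _ / _ in pq q1.
have [r0 r1 _] := tilt_facts l_ge yE nE.
set r := l / (8 * y) in r0 r1.
have z01 : 0 < (1 + r)^-1 <= 1 by rewrite invr_gt0 invf_le1; lra.
apply: (prob_ge_of_finite (Q := fun x => [forall v, ~~ doomed k v x])
  p0 pq q1 (lexx 1)).
- exact: measurableC (measurable_connected k).
- move=> w; rewrite negb_forall => /existsP[v]; rewrite negbK => /and3P[iso nfew nsp].
  have [L0 L1 _] := light_wclasses w pq q1.
  apply: (@isolated_not_connected _ _ _ _ v n1).
  apply: (@isolated_LK _ _ _ p q) => [||e j ev eq je jv].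
  + by rewrite L0; exact/eqP.
  + by rewrite L1; move: nfew; rewrite /few iso /= -leqNgt.
  + rewrite L0; move/forall_inP: nsp => /(_ e ev).
    rewrite /spoilt iso ffunE (below1E _ pq) eq /= negb_exists => /forallP/(_ j).
    by rewrite je jv /= -leqNgt.
apply: le_trans (no_doomed_bound p0 pq q1 (lexx 1) k n1 p1 z01) _.
have A1 := expected_isolated_large l_ge yE nE.
have A2 := low_variance_term l_ge yE nE.
have A3 := few_term l_ge yE nE k_le.
have A4 := spoilt_term l_ge yE nE k_le; cbv zeta in A4.
rewrite -/p in A1 A2 A3 A4; rewrite -/q in A3 A4; rewrite -/r in A4.
have {}A1 : 4 / (n%:R * (1 - p) ^+ n.-1) <= 4 * expR (- l).
  rewrite ler_pM2l // expRN lef_pV2 ?posrE ?expR_gt0 //.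
  by apply: lt_le_trans A1; exact: expR_gt0.
have -> : 12 * expR (- l) = 4 * expR (- l) + 4 * expR (- l) +
    2 * (expR (- l) + expR (- l)) by ring.
apply: lerD; first by apply: lerD A1 _; rewrite ler_pM2l.
by rewrite ler_pM2l //; exact: lerD A3 A4.
Qed.

(** If none of six bad events occurs then [disconnected_sparse_cut] applies to LK
    with the lowered parameter K, and its conclusion is the sixth event; each of
    the six has a probability of order expR (- l) = 1 / ln n. *)
Lemma connected_prob k : y ^+ 2 + l * y / 2 <= k%:R ->
  ((1 - 7 * expR (- l))%:E <= P [set w | graph_connected (LK (wt w) k)])%E.
Proof.
move=> k_ge; have [f1 f2 f3 f4 f5] := scale_facts l_ge yE nE.
have hl := l_ge; have hy := scale_y_ge l_ge yE.
have m0 := scale_n_gt0 l_ge yE nE.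
have y0 : 0 < y by lra.
have n1 := scale_n_gt1 l_ge yE nE.
(* K is the least integer above the bound; LK grows with its parameter. *)
have [K [K_ge K_le Kk]] : exists K, [/\ y ^+ 2 + l * y / 2 <= K%:R,
    K%:R <= y ^+ 2 + l * y / 2 + 1 & (K <= k)%N].
  have ex : exists K, y ^+ 2 + l * y / 2 <= K%:R by exists k.
  case: (ex_minnP ex) => K K_ge Kmin; exists K; split=> //; last exact: Kmin.
  case: K K_ge Kmin => [|K] K_ge Kmin; first by lra.
  rewrite -natr1 lerD2r leNgt; apply/negP => h.
  by have := Kmin K (ltW h); rewrite ltnn.
pose b := Num.truncn (n%:R / y).
have b_le : b%:R <= n%:R / y by rewrite truncn_le divr_ge0 // ltW.
have b_ge : n%:R <= 2 * y * b%:R.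
  have := truncnS_gt (n%:R / y); rewrite -/b -natr1 ltr_pdivrMr // => h.
  have : y * y * 4 <= n%:R by rewrite -expr2; nra.
  by nra.
have b0 : (0 < b)%N.
  rewrite lt0n; apply/negP => /eqP b0; move: b_ge; rewrite b0 mulr0 leNgt.
  by rewrite m0.
have [[p00 p0p pq q1] _] := upper_thresholds l_ge yE nE.
have A1 := light_degree_term l_ge yE nE K_ge.
have A2 := heavy_degree_term l_ge yE nE K_le.
have A3 := crowded_term l_ge yE nE K_ge K_le b_ge; cbv zeta in A3.
have A4 := starved_term l_ge yE nE b_le; cbv zeta in A4.
have A5 := choked_term l_ge yE nE K_ge b_le.
have A6 := sparse_cut_term l_ge yE nE; cbv zeta in A6.
set e := expR 3 in A1 A5 p00 p0p; set p0 := y ^+ 2 / (e * _) in p00 p0p A1 A6.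
set p := (_ + _) / _ in p0p pq A3 A4 A5; set q := 16 * _ / _ in pq q1 A2 A6.
have e1 : 1 <= e by rewrite /e -expR0 ler_expR.
have [r0 r1 _] := tilt_facts l_ge yE nE.
set r := l / (8 * y) in r0 r1 A3.
pose Q1 (x : {ffun edge n -> 'I_4}) := [exists v, (K < #|lightc 0 x :&: star v|)%N].
pose Q2 (x : {ffun edge n -> 'I_4}) := [exists v, (#|lightc 2 x :&: star v| <= K)%N].
pose Q3 (x : {ffun edge n -> 'I_4}) := (b < #|crowded K x|)%N.
pose Q4 (x : {ffun edge n -> 'I_4}) := [exists v, starved K b v x].
pose Q5 (x : {ffun edge n -> 'I_4}) := [exists v, choked K b v x].
pose Q6 (x : {ffun edge n -> 'I_4}) :=
  [exists S : {set 'I_n}, ((0 < #|S|)%N && (#|S|.*2 <= n)%N) && sparse_cut S x].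
apply: (prob_ge_of_finite
  (Q := predU Q1 (predU Q2 (predU Q3 (predU Q4 (predU Q5 Q6))))) p00 p0p pq q1).
- exact: measurable_connected.
- move=> w /=; rewrite !negb_or => /and5P[/existsPn h1 /existsPn h2 h3 /existsPn h4].
  move=> /andP[/existsPn h5 /existsPn h6].
  have [L0 L1 L2] := light_wclasses w p0p pq.
  apply: graph_connected_sub (LK_mono Kk) _.
  have s0 : light (wt w) p0 \subset LKedges (wt w) K.
    by apply: light_sub_LKedges => v; rewrite L0 leqNgt h1.
  have s2 : LKedges (wt w) K \subset light (wt w) q.
    apply/fintype.subsetP => f fL.
    have /card_gt0P[v vf] : (0 < #|val f|)%N by rewrite (eqP (valP f)).
    apply: (LKedges_light _ vf fL); rewrite L2 ltnW // ltnNge; exact: h2.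
  have deg v : (1 < #|LKedges (wt w) K :&: star v|)%N.
    have satb : (#|sat K v (wclasses p0 p q W w)| <= b)%N.
      by apply: leq_trans (card_sat _ _ _) _; rewrite leqNgt.
    apply: (@LKdegree_ge2 _ _ _ p); rewrite L1.
      by have := h4 v; rewrite /starved satb /= -ltnNge.
    have := h5 v; rewrite /choked satb /= -ltnNge -ltnS prednK //.
    by rewrite -(ltr0n R); lra.
  apply: contrapT => nconn.
  have [S [S0 S2 c0 ins]] := disconnected_sparse_cut s0 s2 deg nconn.
  have := h6 S; rewrite S0 S2 /= /sparse_cut S0 S2 /= -L0 c0 eqxx /= -L2 => /negP.
  by apply.
have t12 := le_trans pq q1.
have m_ge0 := pclass_ge0 p00 p0p pq q1.
have m_sum1 := pclass_sum1 p0 p q.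
have PE (Q : 'I_n -> pred {ffun edge n -> 'I_4}) a :
    (forall v, Pr (pclass p0 p q) (Q v) <= a) -> n%:R * a <= expR (- l) ->
    Pr (pclass p0 p q) (fun x => [exists v, Q v x]) <= expR (- l).
  move=> h; apply: le_trans.
  by have := Pr_exists_le m_ge0 h; rewrite card_ord.
have B1 : Pr (pclass p0 p q) Q1 <= expR (- l).
  apply: PE A1 => v; apply: le_trans (card_lightc_ge_tail p00 p0p pq q1 (star v) 0 K.+1 e1) _.
  by rewrite mass_below0 card_star.
have B2 : Pr (pclass p0 p q) Q2 <= expR (- l).
  apply: PE A2 => v; have h2 : 0 < (2^-1 : R) <= 1 by lra.
  apply: le_trans (card_lightc_le_tail p00 p0p pq q1 (star v) 2 K h2) _.
  by rewrite mass_below2 card_star.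
have B3 : Pr (pclass p0 p q) Q3 <= expR (- l).
  by apply: le_trans (crowded_bound p00 p0p pq q1 K _ b0) A3; lra.
have B4 : Pr (pclass p0 p q) Q4 <= expR (- l).
  apply: PE A4 => v; apply: starved_bound => //.
  by rewrite expR_gt0 -expR0 ler_expR; lra.
have B5 : Pr (pclass p0 p q) Q5 <= expR (- l).
  by apply: PE A5 => v; apply: choked_bound.
have B6 : Pr (pclass p0 p q) Q6 <= 2 * expR (- l).
  apply: le_trans A6; apply: le_trans (Pr_exists m_ge0 _ _) _.
  apply: ler_sum => S _; apply: sparse_cut_bound => //.
  by rewrite lerDl divr_ge0 // mulr_ge0 ?sqr_ge0.
have -> : 7 * expR (- l) = expR (- l) + (expR (- l) + (expR (- l) +
    (expR (- l) + (expR (- l) + 2 * expR (- l))))) by ring.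
by do 5!(apply: le_trans (Pr_or m_ge0 _ _) _; apply: lerD => //).
Qed.

End FixedSize.

Section Limit.
Local Open Scope classical_set_scope.
Local Open Scope ring_scope.
Context {R : realType}.

Lemma near_lnln (C : R) : \forall n \near \oo, C <= ln (ln n%:R).
Proof.
exists (Num.truncn (expR (expR C))).+1 => // n /= Nn.
have h : expR (expR C) <= n%:R.
  by apply: le_trans (ltW (truncnS_gt _)) _; rewrite ler_nat.
have L : expR C <= ln n%:R.
  by rewrite -[X in X <= _]expRK ler_ln ?posrE ?expR_gt0 // (lt_le_trans _ h) ?expR_gt0.
by rewrite -[X in X <= _]expRK ler_ln ?posrE ?expR_gt0 // (lt_le_trans _ L) ?expR_gt0.
Qed.

Lemma whp_of_lnln_bound (d : nat -> measure_display) (T : forall n, measurableType (d n))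
    (P : forall n, probability (T n) R) (E : forall n, set (T n)) (c : R) :
  (forall n, measurable (E n)) -> 0 < c ->
  (\forall n \near \oo, ((1 - c * expR (- ln (ln n%:R)))%:E <= P n (E n))%E) ->
  whp P E.
Proof.
move=> mE c0 h; rewrite /whp.
have fin n : P n (E n) \is a fin_num.
  by rewrite ge0_fin_numE // (le_lt_trans (probability_le1 _ _)) ?ltry.
apply: cvg_EFin; first by near=> n; exact: fin.
apply/cvgrPdist_le => eps eps0.
near=> n.
have h1 : ((1 - c * expR (- ln (ln n%:R)))%:E <= P n (E n))%E by near: n.
have h2 : ln (c / eps) <= ln (ln n%:R) by near: n; exact: near_lnln.
have h3 : (P n (E n) <= 1)%E by apply: probability_le1.
rewrite /= -(fineK (fin n)) lee_fin in h1; rewrite -(fineK (fin n)) lee_fin in h3.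
rewrite ger0_norm ?subr_ge0 //.
have h4 : expR (- ln (ln n%:R)) <= eps / c.
  apply: le_trans (_ : expR (- ln (c / eps)) <= _); first by rewrite ler_expR lerN2.
  by rewrite expRN lnK ?posrE ?divr_gt0 // invf_div.
have : c * expR (- ln (ln n%:R)) <= eps.
  by rewrite mulrC -ler_pdivlMr.
move=> h5; rewrite [X in _ - X]/= lerBlDr addrC -lerBlDr.
by apply: le_trans h1; rewrite lerD2l lerN2.
Unshelve. all: by end_near.
Qed.

End Limit.

Local Open Scope classical_set_scope.
Local Open Scope ring_scope.

Theorem theorem1p1 (R : realType)
  (d : nat -> measure_display) (T : forall n, measurableType (d n))
  (P : forall n, probability (T n) R)
  (W : forall n, edge n -> {RV (P n) >-> R})
  (hW : forall n, iid_uniform01 (@W n))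
  (k : nat -> nat) (hk : forall n, (1 <= n)%N -> (1 <= k n <= n)%N)
  (t' : R) :
  (t' < - 2^-1 ->
   (\forall n \near \oo,
      (k n)%:R <= ln n%:R + t' * ln (ln n%:R) * Num.sqrt (ln (n%:R : R))) ->
   whp P (fun n => [set w | ~ graph_connected (LK (fun e => W n e w) (k n))]))
  /\
  (2^-1 < t' ->
   (\forall n \near \oo,
      ln n%:R + t' * ln (ln n%:R) * Num.sqrt (ln (n%:R : R)) <= (k n)%:R) ->
   whp P (fun n => [set w | graph_connected (LK (fun e => W n e w) (k n))])).
Proof.
have scale n : 200 <= ln (ln (n%:R : R)) ->
    [/\ Num.sqrt (ln (n%:R : R)) = expR (ln (ln n%:R) / 2),
        ln (n%:R : R) = expR (ln (ln n%:R) / 2) ^+ 2 &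
        n%:R = expR (expR (ln (ln n%:R) / 2) ^+ 2) :> R].
  move=> h; have L0 : 0 < ln (n%:R : R).
    by rewrite ltNge; apply/negP => /ln0 L0; move: h; rewrite L0; lra.
  have n0 : 0 < n%:R :> R.
    by rewrite ltNge; apply/negP => /ln0 n0; rewrite n0 ltxx in L0.
  have E : expR (ln (ln n%:R) / 2) ^+ 2 = ln (n%:R : R).
    by rewrite -expRM_natr divfK // lnK.
  by rewrite E lnK // -[X in Num.sqrt X]E sqrtr_sqr ger0_norm ?expR_ge0.
split=> ht kn.
- apply: (@whp_of_lnln_bound _ _ _ _ _ 12) => //.
    by move=> n; apply: measurableC; exact: measurable_connected.
  near=> n; have h : 200 <= ln (ln (n%:R : R)) by near: n; exact: near_lnln.
  have [sE LE nE] := scale n h.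
  apply: (disconnected_prob (hW n) h erefl nE).
  have : (k n)%:R <= ln n%:R + t' * ln (ln n%:R) * Num.sqrt (ln (n%:R : R)) by near: n.
  rewrite sE {1}LE; move: (ln (ln n%:R)) h => l h; set y := expR (l / 2).
  have : 0 <= (- 2^-1 - t') * (l * y).
    by apply: mulr_ge0; [lra | apply: mulr_ge0; [lra | exact: expR_ge0]].
  lra.
- apply: (@whp_of_lnln_bound _ _ _ _ _ 7) => //.
    by move=> n; exact: measurable_connected.
  near=> n; have h : 200 <= ln (ln (n%:R : R)) by near: n; exact: near_lnln.
  have [sE LE nE] := scale n h.
  apply: (connected_prob (hW n) h erefl nE).
  have : ln n%:R + t' * ln (ln n%:R) * Num.sqrt (ln (n%:R : R)) <= (k n)%:R by near: n.
  rewrite sE {1}LE; move: (ln (ln n%:R)) h => l h; set y := expR (l / 2).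
  have : 0 <= (t' - 2^-1) * (l * y).
    by apply: mulr_ge0; [lra | apply: mulr_ge0; [lra | exact: expR_ge0]].
  lra.
Unshelve. all: by end_near.
Qed.
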